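(* Let $(A,\phi_{0})$ be a Jacobi algebroid over a manifold $M$, $\pi$ a Jacobi structure on $(A,\phi_{0})$, $\omega$ a $\phi_{0}$-presymplectic structure on $(A,\phi_{0})$ and $N$ a $(1,1)$-tensor field on $A$. Then: (i) If $(\pi,\omega)$ is a J$\Omega$-structure on $(A,\phi_{0})$, then $(\overline{\mathrm{graph}\,\pi^{\sharp}},\mathrm{graph}\,\omega^{\flat})$ is a Dirac pair on $(A,\phi_{0})$. Conversely, if $(\overline{\mathrm{graph}\,\pi^{\sharp}},\mathrm{graph}\,\omega^{\flat})$ is a Dirac pair on $(A,\phi_{0})$ and $\pi$ is non-degenerate, then $(\pi,\omega)$ is a J$\Omega$-structure on $(A,\phi_{0})$. (ii) If $(\omega,N)$ is an $\Omega$N-structure on $(A,\phi_{0})$ and $\mathrm{N}_{(\omega,N)}^{+}=\mathrm{N}_{L,L'}^{*}$, where $L:=\mathrm{graph}\,\omega^{\flat}$ and $L':=\mathrm{graph}\,\omega_{N}^{\flat}$, then $(L,L')$ is a Dirac pair on $(A,\phi_{0})$. Conversely, if $(\mathrm{graph}\,\omega^{\flat},\mathrm{graph}\,\omega_{N}^{\flat})$ is a Dirac pair on $(A,\phi_{0})$, then $(\omega,N)$ is a weak $\Omega$N-structure on $(A,\phi_{0})$.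
   Context: Lie algebroids. A Lie algebroid over $M$ is a vector bundle $A\to M$ with a Lie bracket $[\cdot,\cdot]_A$ on $\Gamma(A)$ and a bundle map $\rho_A:A\to TM$ with $[X,fY]_A=f[X,Y]_A+(\rho_A(X)f)Y$. The Schouten bracket on $\Gamma(\Lambda^*A)$ is the unique extension of the Lie bracket with $[f,g]_A=0$, $[X,f]_A=\rho_A(X)f$, $[D_1,D_2\wedge D_3]_A=[D_1,D_2]_A\wedge D_3+(-1)^{(a_1+1)a_2}D_2\wedge[D_1,D_3]_A$, $[D_1,D_2]_A=-(-1)^{(a_1-1)(a_2-1)}[D_2,D_1]_A$ for $D_i\in\Gamma(\Lambda^{a_i}A)$. The differential $d_A$ on $\Gamma(\Lambda^*A^* )$ is the usual Lie algebroid differential: $(d_A\omega)(X_0,\dots,X_k)=\sum_i(-1)^i\rho_A(X_i)(\omega(X_0,\dots,\hat X_i,\dots,X_k))+\sum_{i<j}(-1)^{i+j}\omega([X_i,X_j]_A,X_0,\dots,\hat X_i,\dots,\hat X_j,\dots,X_k)$. Jacobi algebroids. A Jacobi algebroid $(A,\phi_0)$ is a Lie algebroid $A$ with $\phi_0\in\Gamma(A^* )$, $d_A\phi_0=0$. For $D_i\in\Gamma(\Lambda^{a_i}A)$, $[D_1,D_2]_{A,\phi_0}:=[D_1,D_2]_A+(a_1-1)D_1\wedge\iota_{\phi_0}D_2-(-1)^{a_1+1}(a_2-1)\iota_{\phi_0}D_1\wedge D_2$. On $\Gamma(\Lambda^*A^* )$, $d_{A,\phi_0}\omega:=d_A\omega+\phi_0\wedge\omega$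 and $\mathcal{L}^{A,\phi_0}_X:=\iota_Xd_{A,\phi_0}+d_{A,\phi_0}\iota_X$. A Jacobi structure on $(A,\phi_0)$ is $\pi\in\Gamma(\Lambda^2A)$ with $[\pi,\pi]_{A,\phi_0}=0$. A $\phi_0$-presymplectic structure is $\omega\in\Gamma(\Lambda^2A^* )$ with $d_{A,\phi_0}\omega=0$. Put $\langle\pi^\sharp\xi,\eta\rangle:=\pi(\xi,\eta)$ and $\langle\omega^\flat X,Y\rangle:=\omega(X,Y)$; $\pi$ is non-degenerate if $\pi^\sharp:A^*\to A$ is invertible. J$\Omega$-structures. $(\pi,\omega)$ with $\pi\in\Gamma(\Lambda^2A)$, $\omega\in\Gamma(\Lambda^2A^* )$ is a J$\Omega$-structure on $(A,\phi_0)$ if $\pi$ is a Jacobi structure and both $\omega$ and $\omega_{N'}$ are $d_{A,\phi_0}$-closed, where $N':=\pi^\sharp\circ\omega^\flat$ and $\omega_{N'}\in\Gamma(\Lambda^2A^* )$ is characterized by $\omega_{N'}^\flat=\omega^\flat\circ N'$. $\Omega$N-structures. A $(1,1)$-tensor field on $A$ is a bundle map $N:A\to A$ over the identity, with dual $N^*:A^*\to A^*$ and torsion $\mathcal{T}_N(X,Y):=[NX,NY]_A-N[NX,Y]_A-N[X,NY]_A+N^2[X,Y]_A$; $N$ is Nijenhuis if $\mathcal{T}_N=0$. Put $\omega_N^\flat:=\omega^\flat\circ N:A\to A^*$; when $\omega^\flat\circ N=N^*\circ\omega^\flat$ this is the map associated with a 2-cosection $\omega_N\in\Gamma(\Lambda^2A^*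 )$. $(\omega,N)$ is an $\Omega$N-structure on $(A,\phi_0)$ if $\omega^\flat\circ N=N^*\circ\omega^\flat$, $N$ is Nijenhuis, and both $\omega$ and $\omega_N$ are $d_{A,\phi_0}$-closed. It is a weak $\Omega$N-structure if the same holds with $\mathcal{T}_N=0$ replaced by $\omega^\flat(\mathcal{T}_N(X,Y))=0$ for all $X,Y\in\Gamma(A)$. For a weak $\Omega$N-structure, $\mathrm{N}^+_{(\omega,N)}:=\{(\omega^\flat X,\omega_N^\flat X)\mid X\in A\}\subset A^*\times A^*$ (fibrewise), which is contained in $\mathrm{N}_{L,L'}^*$ for $L=\mathrm{graph}\,\omega^\flat$, $L'=\mathrm{graph}\,\omega_N^\flat$. Dirac structures on $(A,\phi_0)$. On $A\oplus A^*$ let $(X+\xi,Y+\eta)_\pm:=\frac12(\langle\xi,Y\rangle\pm\langle\eta,X\rangle)$ and $[\![X+\xi,Y+\eta]\!]:=[X,Y]_A+\big(\mathcal{L}^{A,\phi_0}_X\eta-\mathcal{L}^{A,\phi_0}_Y\xi+d_{A,\phi_0}(X+\xi,Y+\eta)_-\big)$. A Dirac structure on $(A,\phi_0)$ is a subbundle $L\subset A\oplus A^*$ maximally isotropic for $(\cdot,\cdot)_+$ with $\Gamma(L)$ closed under $[\![\cdot,\cdot]\!]$. Subsets of $A\oplus A^*$ are viewed as fibrewise relations in $A\times A^*$: $\overline{\mathrm{graph}\,\pi^\sharp}:=\{(\pi^\sharp\xi,\xi)\mid\xi\in A^*\}$, and $\mathrm{graph}\,\omega^\flat:=\{(X,\omega^\flat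 X)\mid X\in A\}$, likewise for $\omega_N^\flat$. Relations and Dirac pairs. Relations between vector bundles over the same base are understood fibrewise. For $R\subset A\times A$, $R^*:=\{(\beta,\alpha)\in A^*\times A^*\mid\langle\alpha,u\rangle=\langle\beta,v\rangle\ \forall(u,v)\in R\}$ fibrewise; $\underline{R}$ is the set of pairs of sections with values in $R$ at every point. The Nijenhuis torsion of $R$ is $\mathcal{T}_R((X_1,Y_1),(X_2,Y_2),(\alpha,\beta,\gamma)):=\langle\alpha,[Y_1,Y_2]_A\rangle-\langle\beta,[Y_1,X_2]_A+[X_1,Y_2]_A\rangle+\langle\gamma,[X_1,X_2]_A\rangle$ for $(X_i,Y_i)\in\underline{R}$ and $(\alpha,\beta),(\beta,\gamma)\in\underline{R^*}$; $R$ is Nijenhuis if $\mathcal{T}_R\equiv0$. For $L,L'\subset A\times A^*$, $\mathrm{N}_{L,L'}:=\{(x,y)\in A\times A\mid\exists\alpha\in A^*:(x,\alpha)\in L',\ (y,\alpha)\in L\}$ (fibrewise). A pair $(L,L')$ of Dirac structures on $(A,\phi_0)$ is a Dirac pair on $(A,\phi_0)$ if $\mathrm{N}_{L,L'}$ is a Nijenhuis relation. *)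

(* Defs.v *)
From HB Require Import structures.
From mathcomp Require Import all_boot all_order all_algebra.
From mathcomp Require Import all_classical all_reals all_analysis.
Set Implicit Arguments.
Unset Strict Implicit.
Unset Printing Implicit Defensive.
Import Order.TTheory GRing.Theory Num.Theory numFieldNormedType.Exports.

Local Open Scope classical_set_scope.
Local Open Scope ring_scope.

(** * Smooth manifolds *)

(* Functions are total; [Ck k U f] only constrains [f] on [U], which is open
   wherever it is used.  The derivative of [f] is C^k iff all its directional
   derivatives are, the dimension being finite. *)
Fixpoint Ck (R : realType) (n k : nat) (U : set 'rV[R]_n)
    (f : 'rV[R]_n -> R) : Prop :=
  if k is k'.+1 then
    (forall x, U x -> differentiable f x) /\
    (forall v : 'rV[R]_n, Ck k' U (fun x => 'D_v f x))
  else forall x, U x -> {for x, continuous f}.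

Definition smooth_on (R : realType) (n : nat) (U : set 'rV[R]_n)
    (f : 'rV[R]_n -> R) : Prop := forall k, Ck k U f.

(* A chart is a homeomorphism from the open set [cdom] onto the open set
   [cmap @` cdom]; [cmap] and [cinv] are arbitrary outside these sets. *)
Record chart (R : realType) (n : nat) (M : topologicalType) := Chart {
  cdom : set M;
  cmap : M -> 'rV[R]_n;
  cinv : 'rV[R]_n -> M;
  cdom_open : open cdom;
  cimg_open : open (cmap @` cdom);
  cmapK : forall x, cdom x -> cinv (cmap x) = x;
  cmap_continuous : forall x, cdom x -> {for x, continuous cmap};
  cinv_continuous : forall y, (cmap @` cdom) y -> {for y, continuous cinv} }.

Arguments cmap {R n M} c x.
Arguments cinv {R n M} c y.

Record manifold (R : realType) (n : nat) := Manifold {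
  mspace :> topologicalType;
  mspace_hausdorff : hausdorff_space mspace;
  mspace_second_countable : @second_countable mspace;
  atlas : set (chart R n mspace);
  atlas_cover : forall x, exists2 c, atlas c & cdom c x;
  atlas_compat : forall c c', atlas c -> atlas c' -> forall j : 'I_n,
    smooth_on (cmap c @` (cdom c `&` cdom c'))
              (fun y => cmap c' (cinv c y) 0 j) }.

Arguments atlas {R n} m.

Definition smooth_fun (R : realType) (n : nat) (M : manifold R n) (U : set M)
    (f : M -> R) : Prop :=
  forall c, atlas M c -> smooth_on (cmap c @` (cdom c `&` U)) (f \o cinv c).

Definition Cinf (R : realType) (n : nat) (M : manifold R n) : set (M -> R) :=
  [set f | smooth_fun setT f].

Arguments Cinf {R n} M.

(** * Vector bundles *)

(* A vector bundle of rank [r] is given by its fibres and by local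
   trivialisations covering the base, with smooth transition functions.
   [tmap] and [tinv] are arbitrary linear maps over points outside [tdom]. *)
Record trivialisation (R : realType) (n : nat) (M : manifold R n)
    (fib : M -> vectType R) (r : nat) := Trivialisation {
  tdom : set M;
  tmap : forall x, 'Hom(fib x, 'rV[R]_r);
  tinv : forall x, 'Hom('rV[R]_r, fib x);
  tdom_open : open tdom;
  tmapK : forall x, tdom x -> cancel (tmap x) (tinv x);
  tinvK : forall x, tdom x -> cancel (tinv x) (tmap x) }.

Arguments tmap {R n M fib r} t {x}.
Arguments tinv {R n M fib r} t {x}.

Record vbundle (R : realType) (n : nat) (M : manifold R n) (r : nat) :=
  VBundle {
  fib :> M -> vectType R;
  trivs : set (trivialisation fib r);
  trivs_cover : forall x, exists2 t, trivs t & tdom t x;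
  trivs_compat : forall t t', trivs t -> trivs t' -> forall i j : 'I_r,
    smooth_fun (tdom t `&` tdom t')
      (fun x => tmap t' (tinv t (delta_mx 0 i) : fib x) 0 j) }.

Arguments fib {R n M r} E x : rename.
Arguments trivs {R n M r} E : rename.

Section Bundles.
Context (R : realType) (n : nat) (M : manifold R n).

Definition frame (r : nat) (fib : M -> vectType R) (t : trivialisation fib r)
  (i : 'I_r) (x : M) : fib x := tinv t (delta_mx 0 i).

(* Not necessarily smooth sections. *)
Definition rsec (r : nat) (E : vbundle M r) : Type := forall x, E x.

Definition smooth_sec_on (r : nat) (E : vbundle M r) (U : set M)
    (X : rsec E) : Prop :=
  forall t, trivs E t -> forall j : 'I_r,
    smooth_fun (tdom t `&` U) (fun x => tmap t (X x) 0 j).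

Definition Gamma (r : nat) (E : vbundle M r) : set (rsec E) :=
  [set X | smooth_sec_on setT X].

Arguments Gamma {r} E.

(* Vector bundle morphisms over the identity of [M]. *)
Definition bundle_map (r r' : nat) (E : vbundle M r) (F : vbundle M r')
    (h : forall x, 'Hom(E x, F x)) : Prop :=
  forall t t', trivs E t -> trivs F t' ->
  forall (i : 'I_r) (j : 'I_r'),
    smooth_fun (tdom t `&` tdom t')
      (fun x => tmap t' (h x (frame t i x)) 0 j).

(** ** Dual bundle *)

Section Dual.
Context (r : nat) (E : vbundle M r).

Definition dfib (x : M) : vectType R := 'Hom(E x, R^o).

(* Coordinates in the dual of the frame defined by [t]. *)
Definition dtmap (t : trivialisation E r) (x : M) : 'Hom(dfib x, 'rV[R]_r) :=
  linfun (fun xi : dfib x => \row_i (xi (frame t i x) : R)).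

Definition dtinv_fun (t : trivialisation E r) (x : M) (w : 'rV[R]_r) :
    dfib x :=
  linfun (fun u : E x => (\sum_i w 0 i * tmap t u 0 i : R^o)).

Definition dtinv (t : trivialisation E r) (x : M) : 'Hom('rV[R]_r, dfib x) :=
  linfun (@dtinv_fun t x).

End Dual.

Lemma linfunE (aT rT : vectType R) (f : aT -> rT) : linear f -> linfun f =1 f.
Proof.
move=> lin u; pose f' := GRing.isLinear.Build R aT rT *:%R f lin.
by rewrite -[LHS]/(linfun (HB.pack_for {linear aT -> rT} f f') u) lfunE.
Qed.

Section DualTheory.
Context (r : nat) (E : vbundle M r).
Implicit Types (t : trivialisation E r) (x : M).

Lemma dtmapE t x (xi : dfib E x) (i : 'I_r) :
  dtmap t x xi 0 i = xi (frame t i x).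
Proof.
rewrite linfunE ?mxE // => a u v.
by apply/rowP => j; rewrite !mxE lfunE /= lfunE.
Qed.

Lemma dtinvE t x (w : 'rV[R]_r) (u : E x) :
  dtinv t x w u = \sum_i w 0 i * tmap t u 0 i.
Proof.
have lin w' : linear (fun u : E x => (\sum_i w' 0 i * tmap t u 0 i : R^o)).
  move=> a y z; rewrite scaler_sumr -big_split /=.
  by apply: eq_bigr => i _; rewrite linearP !mxE mulrDr mulrCA.
rewrite linfunE ?linfunE // => a y z; apply/lfunP => e.
rewrite lfunE /= lfunE /= !linfunE // scaler_sumr -big_split /=.
by apply: eq_bigr => i _; rewrite !mxE mulrDl -mulrA.
Qed.

Lemma dtmapK t x : tdom t x -> cancel (dtmap t x) (dtinv t x).
Proof.
move=> tx xi; apply/lfunP => u; rewrite dtinvE.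
rewrite -[in RHS](tmapK tx u) [in RHS](row_sum_delta (tmap t u)) !linear_sum.
by apply: eq_bigr => i _; rewrite !linearZ dtmapE mulrC.
Qed.

Lemma dtinv_frame t t' x i j :
  dtinv t x (delta_mx 0 i) (frame t' j x) = tmap t (frame t' j x) 0 i.
Proof.
rewrite dtinvE (bigD1 i) //= mxE !eqxx mul1r big1 ?addr0 // => k ki.
by rewrite mxE (negbTE ki) andbF mul0r.
Qed.

Lemma dtinvK t x : tdom t x -> cancel (dtinv t x) (dtmap t x).
Proof.
move=> tx w; apply/rowP => j; rewrite dtmapE dtinvE /frame tinvK //.
rewrite (bigD1 j) //= mxE !eqxx mulr1 big1 ?addr0 // => i ij.
by rewrite mxE eqxx (negbTE ij) mulr0.
Qed.

Definition dtriv t : trivialisation (dfib E) r :=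
  Trivialisation (tdom_open t) (@dtmapK t) (@dtinvK t).

Lemma dual_cover x :
  exists2 t, (dtriv @` trivs E) t & tdom t x.
Proof.
by have [t Et tx] := trivs_cover E x; exists (dtriv t) => //; exists t.
Qed.

Lemma dual_compat (t t' : trivialisation (dfib E) r) :
  (dtriv @` trivs E) t ->
  (dtriv @` trivs E) t' -> forall i j : 'I_r,
    smooth_fun (tdom t `&` tdom t')
      (fun x => tmap t' (tinv t (delta_mx 0 i) : dfib E x) 0 j).
Proof.
move=> [s Es <-] [s' Es' <-] i j /=; rewrite setIC.
have -> : (fun x => dtmap s' x (dtinv s x (delta_mx 0 i)) 0 j) =
    (fun x => tmap s (frame s' j x : E x) 0 i).
  by apply: funext => x; rewrite dtmapE dtinv_frame.
exact: trivs_compat.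
Qed.

Definition dualb : vbundle M r := VBundle dual_cover dual_compat.

End DualTheory.

(** * Exterior algebra *)

(* An element of the exterior algebra of a dual space V^* is encoded as a
   function on [seq V]: its component of degree k is the alternating
   multilinear map given by its restriction to the sequences of size k. *)

(* Number of pairs [i < j] such that [mask m s] selects the j-th entry of [s]
   but not the i-th one. *)
Definition inversions (k : nat) (m : k.-tuple bool) : nat :=
  \sum_(i < k) \sum_(j < k | (i < j)%N) (~~ tnth m i && tnth m j).

(* Sum over the shuffles, coded by bit masks:
   (f /\ g)(u, v) = f(u) g(v) - f(v) g(u) in degrees (1, 1). *)
Definition wedge (T : Type) (f g : seq T -> R) (s : seq T) : R :=
  \sum_(m : (size s).-tuple bool)
    (-1) ^+ inversions m * f (mask m s) * g (mask (map negb m) s).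

Definition contract (T S : Type) (u : T) (f : seq T -> S) (s : seq T) : S :=
  f (u :: s).

(* Not necessarily smooth, alternating or homogeneous sections of the exterior
   algebra bundle of the dual of [E]. *)
Definition rform (r : nat) (E : vbundle M r) : Type := forall x, seq (E x) -> R.

(* [w] is a smooth section of the [k]-th exterior power of the dual of [E]. *)
Record kform (r : nat) (E : vbundle M r) (k : nat) (w : rform E) : Prop :=
  Kform {
  kform_degree : forall x (s : seq (E x)), size s != k -> w x s = 0;
  kform_linear : forall x (s1 s2 : seq (E x)) (a : R) (u v : E x),
    w x (s1 ++ (a *: u + v) :: s2) =
    a * w x (s1 ++ u :: s2) + w x (s1 ++ v :: s2);
  kform_alternating : forall x (s1 s2 s3 : seq (E x)) (u : E x),
    w x (s1 ++ u :: s2 ++ u :: s3) = 0;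
  kform_smooth : forall t, trivs E t -> forall s : seq 'I_r,
    smooth_fun (tdom t) (fun x => w x [seq frame t i x | i <- s]) }.

Section Algebroids.
Context (r : nat) (A : vbundle M r).

Definition pairing (x : M) (xi : dualb A x) (u : A x) : R :=
  (xi : 'Hom(A x, R^o)) u.

(* Sections of the exterior powers of [A], using A = A^**. *)
Definition rmvec : Type := rform (dualb A).
Definition kmvec (k : nat) (P : rmvec) : Prop := kform k P.

Definition fun_mvec (f : M -> R) : rmvec :=
  fun x s => if s is [::] then f x else 0.

Arguments fun_mvec f x s : clear implicits.

Definition sec_mvec (X : rsec A) : rmvec :=
  fun x s => if s is [:: xi] then pairing xi (X x) else 0.

Arguments sec_mvec X x s : clear implicits.

(** * Lie algebroids *)

(* Tangent vectors at [x] are the derivations of [Cinf M] at [x]. *)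
Definition tangent_vector (x : M) (D : (M -> R) -> R) : Prop :=
  (forall (a : R) f g, Cinf M f -> Cinf M g ->
     D (fun y => a * f y + g y) = a * D f + D g) /\
  (forall f g, Cinf M f -> Cinf M g ->
     D (fun y => f y * g y) = D f * g x + f x * D g).

(* The anchor is a smooth bundle map to the tangent bundle, the latter being
   given by derivations.  The values of [anchor] on non-smooth functions and of
   [lie] on non-smooth sections are irrelevant. *)
Record lie_algebroid := LieAlgebroid {
  anchor : forall x, A x -> (M -> R) -> R;
  anchor_tangent : forall x (u : A x), tangent_vector x (anchor u);
  anchor_linear : forall x (a : R) (u v : A x) f, Cinf M f ->
    anchor (a *: u + v) f = a * anchor u f + anchor v f;
  anchor_smooth : forall X f, Gamma A X -> Cinf M f ->
    Cinf M (fun x => anchor (X x) f);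
  lie : rsec A -> rsec A -> rsec A;
  lie_smooth : forall X Y, Gamma A X -> Gamma A Y -> Gamma A (lie X Y);
  lie_linear : forall (a : R) X Y Z, Gamma A X -> Gamma A Y -> Gamma A Z ->
    forall x, lie (fun y => a *: X y + Y y) Z x = a *: lie X Z x + lie Y Z x;
  lie_skew : forall X Y, Gamma A X -> Gamma A Y ->
    forall x, lie X Y x = - lie Y X x;
  lie_jacobi : forall X Y Z, Gamma A X -> Gamma A Y -> Gamma A Z ->
    forall x, lie X (lie Y Z) x + lie Y (lie Z X) x + lie Z (lie X Y) x = 0;
  lie_leibniz : forall X Y f, Gamma A X -> Gamma A Y -> Cinf M f ->
    forall x, lie X (fun y => f y *: Y y) x =
              f x *: lie X Y x + anchor (X x) f *: Y x }.

Context (LA : lie_algebroid).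

(* [B] is the Schouten bracket of [A]: these properties determine it on all
   smooth homogeneous multisections.  The natural number exponents have
   the parities of (a1 + 1) a2 and (a1 - 1)(a2 - 1). *)
Record is_schouten (B : rmvec -> rmvec -> rmvec) : Prop := IsSchouten {
  schouten_degree : forall p q P Q, kmvec p P -> kmvec q Q ->
    kmvec (p + q).-1 (B P Q);
  schouten_linear : forall (a : R) p q P P' Q,
    kmvec p P -> kmvec p P' -> kmvec q Q -> forall x s,
    B (fun y u => a * P y u + P' y u) Q x s = a * B P Q x s + B P' Q x s;
  schouten_fun : forall f g, Cinf M f -> Cinf M g ->
    forall x s, B (fun_mvec f) (fun_mvec g) x s = 0;
  schouten_anchor : forall X f, Gamma A X -> Cinf M f -> forall x s,
    B (sec_mvec X) (fun_mvec f) x s =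
    fun_mvec (fun y => anchor LA (X y) f) x s;
  schouten_lie : forall X Y, Gamma A X -> Gamma A Y -> forall x s,
    B (sec_mvec X) (sec_mvec Y) x s = sec_mvec (lie LA X Y) x s;
  schouten_leibniz : forall a1 a2 a3 D1 D2 D3,
    kmvec a1 D1 -> kmvec a2 D2 -> kmvec a3 D3 -> forall x s,
    B D1 (fun y => wedge (D2 y) (D3 y)) x s =
    wedge (B D1 D2 x) (D3 x) s +
    (-1) ^+ (a1.+1 * a2) * wedge (D2 x) (B D1 D3 x) s;
  schouten_skew : forall a1 a2 D1 D2, kmvec a1 D1 -> kmvec a2 D2 ->
    forall x s,
    B D1 D2 x s = - ((-1) ^+ (a1.+1 * a2.+1) * B D2 D1 x s) }.

(** * Differential calculus *)

(* Forms on [A], seen as functions of sections of [A]. *)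
Definition cochain : Type := seq (rsec A) -> M -> R.

Definition form_cochain (w : rform A) : cochain :=
  fun s x => w x [seq X x | X : rsec A <- s].

Definition fun_cochain (f : M -> R) : cochain :=
  fun s x => if s is [::] then f x else 0.

Definition sec_cochain (xi : rsec (dualb A)) : cochain :=
  fun s x => if s is [:: X] then pairing (xi x) (X x) else 0.

Definition sec_nth (s : seq (rsec A)) (i : nat) : rsec A :=
  nth (fun x => 0 : A x) s i.

Definition remove (T : Type) (i : nat) (s : seq T) : seq T :=
  take i s ++ drop i.+1 s.

Definition dA (c : cochain) : cochain := fun s x =>
  \sum_(i < size s)
    (-1) ^+ i * anchor LA (sec_nth s i x) (c (remove i s)) +
  \sum_(i < size s) \sum_(j < size s | (i < j)%N)
    (-1) ^+ (i + j) *
    c (lie LA (sec_nth s i) (sec_nth s j) :: remove i (remove j s)) x.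

Definition cochain_zero (c : cochain) : Prop :=
  forall s, all (fun X => X \in Gamma A) s -> forall x, c s x = 0.

Context (phi0 : rsec (dualb A)).

Definition jacobi_algebroid : Prop :=
  Gamma (dualb A) phi0 /\ cochain_zero (dA (sec_cochain phi0)).

Definition dphi (c : cochain) : cochain := fun s x =>
  dA c s x + wedge ((sec_cochain phi0)^~ x) (c^~ x) s.

Definition Lphi (X : rsec A) (c : cochain) : cochain := fun s x =>
  contract X (dphi c) s x + dphi (contract X c) s x.

Definition presymplectic (w : rform A) : Prop :=
  kform 2 w /\ cochain_zero (dphi (form_cochain w)).

(** * Jacobi structures *)

(* The bracket [D1, D2]_{A, phi0} of multisections of degrees a1 and a2, where
   [B] is the Schouten bracket of [A]. *)
Definition jacobi_bracket (B : rmvec -> rmvec -> rmvec) (a1 a2 : nat)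
    (D1 D2 : rmvec) : rmvec := fun x s =>
  B D1 D2 x s
  + (a1%:R - 1) * wedge (D1 x) (contract (phi0 x : dualb A x) (D2 x)) s
  - (-1) ^+ a1.+1 * (a2%:R - 1) *
    wedge (contract (phi0 x : dualb A x) (D1 x)) (D2 x) s.

Arguments jacobi_bracket B a1 a2 D1 D2 x s : clear implicits.

Definition jacobi_structure (B : rmvec -> rmvec -> rmvec) (p : rmvec) : Prop :=
  kmvec 2 p /\ forall x s, jacobi_bracket B 2 2 p p x s = 0.

(** * Bundle maps attached to 2-tensors *)

Definition flat (w : rform A) (x : M) : 'Hom(A x, dualb A x) :=
  linfun (fun u : A x => linfun (fun v : A x => (w x [:: u; v] : R^o))
                         : dualb A x).

(* <sharp p xi, eta> = p(xi, eta), written in a basis of the fibre; see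
   [sharpE]. *)
Definition sharp (p : rmvec) (x : M) : 'Hom(dualb A x, A x) :=
  let b := vbasis (fullv : {vspace A x}) in
  linfun (fun xi : dualb A x =>
    \sum_i p x [:: xi; linfun (coord b i : A x -> R^o) : dualb A x] *: b`_i).

Definition nondegenerate_bivector (p : rmvec) : Prop :=
  forall x, bijective (sharp p x).

Definition dual_map (N : forall x, 'End(A x)) (x : M) : 'End(dualb A x) :=
  linfun (fun xi : dualb A x => ((xi : 'Hom(A x, R^o)) \o N x)%VF : dualb A x).

Definition flatN (w : rform A) (N : forall x, 'End(A x)) (x : M) :
  'Hom(A x, dualb A x) := (flat w x \o N x)%VF.

(* The 2-form [w_N] with associated map [flatN w N], when the latter is
   skew-symmetric. *)
Definition formN (w : rform A) (N : forall x, 'End(A x)) : rform A :=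
  fun x s => if s is [:: u; v] then pairing (flatN w N x u) v else 0.

(** * J-Omega and Omega-N structures *)

Definition JOmega_structure (B : rmvec -> rmvec -> rmvec) (p : rmvec)
    (w : rform A) : Prop :=
  let N' := fun x => (sharp p x \o flat w x)%VF in
  [/\ jacobi_structure B p, presymplectic w & presymplectic (formN w N')].

Definition tensor11 (N : forall x, 'End(A x)) : Prop :=
  @bundle_map r r A A N.

Definition torsion (N : forall x, 'End(A x)) (X Y : rsec A) : rsec A :=
  let NS (Z : rsec A) : rsec A := fun x => N x (Z x) in
  fun x => lie LA (NS X) (NS Y) x - N x (lie LA (NS X) Y x)
           - N x (lie LA X (NS Y) x) + N x (N x (lie LA X Y x)).

Arguments torsion N X Y x : clear implicits.

Definition Nijenhuis (N : forall x, 'End(A x)) : Prop :=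
  forall X Y, Gamma A X -> Gamma A Y -> forall x, torsion N X Y x = 0.

Definition flat_compatible (w : rform A) (N : forall x, 'End(A x)) : Prop :=
  forall x, (flat w x \o N x)%VF = (dual_map N x \o flat w x)%VF.

Definition OmegaN_structure (w : rform A) (N : forall x, 'End(A x)) : Prop :=
  [/\ tensor11 N, flat_compatible w N, Nijenhuis N,
      presymplectic w & presymplectic (formN w N)].

Definition weak_OmegaN_structure (w : rform A) (N : forall x, 'End(A x)) :
    Prop :=
  [/\ tensor11 N, flat_compatible w N,
      forall X Y, Gamma A X -> Gamma A Y ->
        forall x, flat w x (torsion N X Y x) = 0,
      presymplectic w & presymplectic (formN w N)].

Definition Nplus (w : rform A) (N : forall x, 'End(A x)) (x : M) :
    set (dualb A x * dualb A x) :=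
  [set (flat w x u, flatN w N x u) | u in [set: A x]].

Arguments Nplus w N x : clear implicits.

(** * Dirac structures *)

(* Fibrewise relations between [A] and its dual. *)
Definition relAD : Type := forall x, set (A x * dualb A x).

Definition graph_map (h : forall x, 'Hom(A x, dualb A x)) : relAD :=
  fun x => [set (u, h x u) | u in [set: A x]].

Definition cograph_map (h : forall x, 'Hom(dualb A x, A x)) : relAD :=
  fun x => [set (h x xi, xi) | xi in [set: dualb A x]].

Definition pair_plus (x : M) (e1 e2 : A x * dualb A x) : R :=
  2^-1 * (pairing e1.2 e2.1 + pairing e2.2 e1.1).

Definition pair_minus (x : M) (e1 e2 : A x * dualb A x) : R :=
  2^-1 * (pairing e1.2 e2.1 - pairing e2.2 e1.1).

(* Near every point, [L] is spanned by a frame of smooth local sections. *)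
Definition subbundle (L : relAD) : Prop :=
  exists d : nat, forall x0 : M,
  exists (U : set M) (X : 'I_d -> rsec A) (xi : 'I_d -> rsec (dualb A)),
  let e x : seq (A x * dualb A x) := [seq (X i x, xi i x) | i <- enum 'I_d] in
  [/\ open U, U x0,
      forall i, smooth_sec_on U (X i) /\ smooth_sec_on U (xi i),
      forall x, U x -> free (e x) &
      forall x, U x -> L x = [set p | p \in <<e x>>%VS] ].

Definition isotropic (x : M) (S : set (A x * dualb A x)) : Prop :=
  forall e1 e2, S e1 -> S e2 -> pair_plus e1 e2 = 0.

Definition maximally_isotropic (L : relAD) : Prop :=
  forall x, isotropic (L x) /\
  forall V : {vspace (A x * dualb A x)},
    isotropic [set p | p \in V] -> L x `<=` [set p | p \in V] ->
    L x = [set p | p \in V].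

(* The A^*-component of the bracket of [X + xi] and [Y + eta]. *)
Definition courant_cochain (X : rsec A) (xi : rsec (dualb A)) (Y : rsec A)
    (eta : rsec (dualb A)) : cochain := fun s x =>
  Lphi X (sec_cochain eta) s x - Lphi Y (sec_cochain xi) s x
  + dphi (fun_cochain (fun y => pair_minus (X y, xi y) (Y y, eta y))) s x.

(* [zeta] is the section of the dual of [A] representing the A^*-component of
   the bracket. *)
Definition courant_closed (L : relAD) : Prop :=
  forall X xi Y eta, Gamma A X -> Gamma (dualb A) xi -> Gamma A Y ->
  Gamma (dualb A) eta ->
  (forall x, L x (X x, xi x)) -> (forall x, L x (Y x, eta x)) ->
  exists zeta, [/\ Gamma (dualb A) zeta,
    forall W, Gamma A W -> forall x,
      pairing (zeta x) (W x) = courant_cochain X xi Y eta [:: W] x &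
    forall x, L x (lie LA X Y x, zeta x)].

Definition dirac_structure (L : relAD) : Prop :=
  [/\ subbundle L, maximally_isotropic L & courant_closed L].

(** * Nijenhuis relations and Dirac pairs *)

Definition rel_dual (S : forall x, set (A x * A x)) (x : M) :
    set (dualb A x * dualb A x) :=
  [set q | forall u v, S x (u, v) -> pairing q.2 u = pairing q.1 v].

Definition Nrel (L L' : relAD) (x : M) : set (A x * A x) :=
  [set p | exists alpha : dualb A x, L' x (p.1, alpha) /\ L x (p.2, alpha)].

Arguments rel_dual S x : clear implicits.
Arguments Nrel L L' x : clear implicits.

Definition rel_torsion (X1 Y1 X2 Y2 : rsec A)
    (alpha beta gamma : rsec (dualb A)) (x : M) : R :=
  pairing (alpha x) (lie LA Y1 Y2 x)
  - pairing (beta x) (lie LA Y1 X2 x + lie LA X1 Y2 x)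
  + pairing (gamma x) (lie LA X1 X2 x).

Definition Nijenhuis_relation (S : forall x, set (A x * A x)) : Prop :=
  forall X1 Y1 X2 Y2 alpha beta gamma,
  Gamma A X1 -> Gamma A Y1 -> Gamma A X2 -> Gamma A Y2 ->
  Gamma (dualb A) alpha -> Gamma (dualb A) beta -> Gamma (dualb A) gamma ->
  (forall x, S x (X1 x, Y1 x)) -> (forall x, S x (X2 x, Y2 x)) ->
  (forall x, rel_dual S x (alpha x, beta x)) ->
  (forall x, rel_dual S x (beta x, gamma x)) ->
  forall x, rel_torsion X1 Y1 X2 Y2 alpha beta gamma x = 0.

Definition dirac_pair (L L' : relAD) : Prop :=
  [/\ dirac_structure L, dirac_structure L' & Nijenhuis_relation (Nrel L L')].

(** * Characterisation of the bundle maps *)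

Lemma flatE (w : rform A) x (u v : A x) :
  kform 2 w -> pairing (flat w x u) v = w x [:: u; v].
Proof.
move=> kw; have lin u' : linear (fun v : A x => (w x [:: u'; v] : R^o)).
  by move=> a y z; apply: (kform_linear kw [:: u'] [::]).
rewrite /pairing /flat linfunE; first by rewrite linfunE.
move=> a y z; apply/lfunP => e; rewrite lfunE /= lfunE /= !linfunE //.
exact: (kform_linear kw [::] [:: e]).
Qed.

Lemma sharpE (p : rmvec) x (xi eta : dualb A x) :
  kmvec 2 p -> pairing eta (sharp p x xi) = p x [:: xi; eta].
Proof.
move=> kp; set b := vbasis (fullv : {vspace A x}).
rewrite /pairing /sharp linfunE; last first.
  move=> a y z; rewrite scaler_sumr -big_split /=; apply: eq_bigr => i _.
  by rewrite (kform_linear kp [::] [:: _]) scalerDl scalerA.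
have lin : linear (fun e : dualb A x => (p x [:: xi; e] : R^o)).
  by move=> a y z; apply: (kform_linear kp [:: xi] [::]).
have etaE : eta = \sum_(i < \dim {: A x}) ((eta : 'Hom(A x, R^o)) b`_i : R) *:
    (linfun (coord b i : A x -> R^o) : dualb A x).
  apply/lfunP => u; rewrite [in LHS](coord_vbasis (memvf u)) linear_sum.
  rewrite sum_lfunE; apply: eq_bigr => i _.
  by rewrite linearZ lfunE /= lfunE /= [LHS]mulrC.
rewrite -[RHS](linfunE lin) [in RHS]etaE !linear_sum.
apply: eq_bigr => i _; rewrite !linearZ /=.
by rewrite (linfunE lin (linfun _)) [LHS]mulrC.
Qed.

Lemma dual_mapE (N : forall x, 'End(A x)) x (xi : dualb A x) (u : A x) :
  pairing (dual_map N x xi) u = pairing xi (N x u).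
Proof.
rewrite /pairing /dual_map linfunE ?comp_lfunE // => a y z.
by rewrite comp_lfunDl comp_lfunZl.
Qed.

End Algebroids.
End Bundles.

Arguments Gamma {R n M r} E.
Arguments fun_mvec {R n M r A} f x s.
Arguments sec_mvec {R n M r A} X x s.
Arguments jacobi_bracket {R n M r A} phi0 B a1 a2 D1 D2 x s.
Arguments torsion {R n M r A} LA N X Y x.
Arguments Nplus {R n M r A} w N x.
Arguments rel_dual {R n M r A} S x.
Arguments Nrel {R n M r A} L L' x.

(* Main.v *)
(* Part (i) and part (ii) both rest on the Courant bracket of two sections of a
   graph.  For L = graph w it gives d_phi0 w (X, Y, Z) = 0 exactly when L is
   closed under the bracket.  For L = cograph p, the failure of p(zeta) = [X, Y]
   paired with a one-form is half of the Schouten square of p, corrected by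
   phi0; this is checked pointwise by writing p, cut off by a function equal to
   1 with zero differential at the point, as a sum of decomposable bivectors.

   Along L = cograph p, the bracket of (NX, wX) and (NY, wY), N = p o w, has
   dual component zeta with
     zeta(Z) + d w_N(X, Y, Z) = w([NX, Y] + [X, NY] - N[X, Y], Z)
   when d w = 0, and [NX, NY] = p(zeta).  So d w_N = 0 forces the torsion of N to
   vanish, and conversely if p is injective.

   For part (ii), if w1(X_i) = w0(Y_i) and w2(X_i) = w1(Y_i), then
     d w0(Y1, Y2, Z) - d w1(Y1, X2, Z) - d w1(X1, Y2, Z) + d w2(X1, X2, Z)
   equals minus the pairing of Z with the torsion of the relation X_i ~ Y_i.
   With w0 = w, w1 = w_N, w2 = w_{N^2} and Y_i = N X_i it shows that w_{N^2} is
   closed; with arbitrary Y_i such that w Y_i = w N X_i it shows that the relation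
   N_{L, L'} is Nijenhuis, the covectors at a given point being extended freely
   because the torsion is tensorial in them. *)

Require Import Defs.
From HB Require Import structures.
From mathcomp Require Import all_boot all_order all_algebra ring lra.
From mathcomp Require Import all_classical all_reals all_analysis.
Set Implicit Arguments.
Unset Strict Implicit.
Unset Printing Implicit Defensive.
Import Order.TTheory GRing.Theory Num.Theory numFieldNormedType.Exports.
Local Open Scope classical_set_scope.
Local Open Scope ring_scope.

(** * Smooth functions and bump functions *)

Section SmoothFunctions.
Context (R : realType) (n : nat).
Implicit Types (U V : set 'rV[R]_n) (f g : 'rV[R]_n -> R) (k : nat).

(** The first-order expansion of [f] at [x] is also one for [g], since its error bound concerns
    points near [x]; uniqueness of the differential then gives differentiability of [g]. *)
Lemma near_eq_differentiable f g x :
  (\near x, f x = g x) -> differentiable f x -> differentiable g x.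
Proof.
move=> fg df; have gx : g x = f x by rewrite (nbhs_singleton fg).
have cf : continuous ('d f x) by exact: diff_continuous.
have gE : g \o shift x = cst (g x) + 'd f x +o_ 0 id.
  apply/eqaddoP => e e0; have /eqaddoP/(_ e e0) := diff_locally df.
  rewrite gx => fe; near=> h.
  have gf : (g \o shift x) h = (f \o shift x) h; last first.
    by rewrite -[_ h]/((g \o shift x) h - _) gf; near: h.
  apply/esym; rewrite /=; near: h.
  move: fg; rewrite {1}(near_shift 0 x) /= => fg.
  by apply: filterS fg => h; rewrite /= subr0.
apply/diff_locallyP; have dgE := diff_unique cf gE.
by split; [rewrite dgE|rewrite dgE].
Unshelve. all: by end_near. Qed.

Lemma Ck_sub k U V f : V `<=` U -> Ck k U f -> Ck k V f.
Proof.
elim: k f => [|k IH] f VU /=; first by move=> cf x /VU/cf.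
by move=> [df Df]; split=> [x /VU/df //|v]; apply: IH.
Qed.

Lemma Ck_local k U f :
  (forall x, U x -> exists2 V, V x & Ck k V f) -> Ck k U f.
Proof.
elim: k f => [|k IH] f H /=; first by move=> x /H [V Vx]; apply.
split=> [x /H [V Vx [dV _]]|v]; first exact: dV.
by apply: IH => x /H [V Vx [_ DV]]; exists V; [|exact: DV].
Qed.

(** On an open set, agreement at the points of [U] is agreement near each of them, so it passes to
    directional derivatives. *)
Lemma Ck_eq k U f g :
  open U -> (forall x, U x -> f x = g x) -> Ck k U f -> Ck k U g.
Proof.
move=> oU; elim: k f g => [|k IH] f g fg /=.
  move=> cf x Ux; have nfg : \near x, f x = g x.
    by apply: filterS (open_nbhs_nbhs (conj oU Ux)) => y /fg.
  rewrite /prop_for /continuous_at -(fg x Ux).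
  by apply: cvg_trans (cf x Ux); exact: near_eq_cvg nfg.
move=> [df Df]; have nfg x : U x -> \near x, f x = g x.
  by move=> Ux; apply: filterS (open_nbhs_nbhs (conj oU Ux)) => y /fg.
split=> [x Ux|v]; first exact: near_eq_differentiable (nfg x Ux) (df x Ux).
by apply: (IH _ _ _ (Df v)) => x Ux; apply: near_eq_derive; exact: nfg.
Qed.

Lemma Ck_pred k U f : Ck k.+1 U f -> Ck k U f.
Proof.
elim: k f => [|k IH] f [df Df].
  by move=> x Ux; apply: differentiable_continuous; exact: df.
by split=> // v; apply: IH.
Qed.

Lemma Ck_cst k U (a : R) : Ck k U (fun _ => a).
Proof.
elim: k a => [|k IH] a /=; first by move=> x _; exact: cst_continuous.
split=> [x _|v]; first exact: differentiable_cst.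
rewrite [X in Ck _ _ X](_ : _ = (fun=> 0)); first exact: IH.
by apply: funext => x; rewrite (derive_cst a).
Qed.

Lemma CkD k U f g :
  open U -> Ck k U f -> Ck k U g -> Ck k U (fun x => f x + g x).
Proof.
move=> oU; elim: k f g => [|k IH] f g /=.
  by move=> cf cg x Ux; exact: continuousD (cf x Ux) (cg x Ux).
move=> [df Df] [dg Dg]; split=> [x Ux|v].
  exact: differentiableD (df x Ux) (dg x Ux).
apply: (Ck_eq oU _ (IH _ _ (Df v) (Dg v))) => x Ux; apply/esym.
by apply: deriveD; apply: diff_derivable; [exact: df|exact: dg].
Qed.

Lemma CkM k U f g :
  open U -> Ck k U f -> Ck k U g -> Ck k U (fun x => f x * g x).
Proof.
move=> oU; elim: k f g => [|k IH] f g.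
  by move=> cf cg x Ux; exact: continuousM (cf x Ux) (cg x Ux).
move=> Cf Cg; have [[df Df] [dg Dg]] := (Cf, Cg); split=> [x Ux|v].
  exact: differentiableM (df x Ux) (dg x Ux).
(* In the product rule [f] and [g] themselves appear as factors, at one order less. *)
have C := CkD oU (IH _ _ (Ck_pred Cf) (Dg v)) (IH _ _ (Ck_pred Cg) (Df v)).
apply: (Ck_eq oU _ C) => x Ux; apply/esym.
by apply: deriveM; apply: diff_derivable; [exact: df|exact: dg].
Qed.

Lemma CkV k U f :
  open U -> (forall x, U x -> f x != 0) -> Ck k U f ->
  Ck k U (fun x => (f x)^-1).
Proof.
move=> oU f0; elim: k => [|k IH] Cf.
  by move=> x Ux; exact: continuousV (f0 x Ux) (Cf x Ux).
have [df Df] := Cf; split=> [x Ux|v].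
  by apply: differentiableV; [exact: df|exact: f0].
(* The derivative is [- f^-2] times that of [f], and the induction hypothesis handles the inverse at
   order [k]. *)
have CV := IH (Ck_pred Cf).
have C := CkM oU (Ck_cst k U (-1)) (CkM oU (CkM oU CV CV) (Df v)).
apply: (Ck_eq oU _ C) => x Ux; have dx := df x Ux; have fx := f0 x Ux.
rewrite (deriveE v (differentiableV dx fx)) diffV // [in LHS](deriveE v dx).
by rewrite /= /GRing.scale /= expr2 invfM mulN1r mulNr.
Qed.

(* One-variable functions are given together with all their derivatives. *)
Lemma Ck_comp k U f (h : nat -> R -> R) :
  open U -> (forall m t, derivable (h m) t 1) ->
  (forall m, exists c : seq (R * nat),
     forall t, 'D_1 (h m) t = \sum_(b <- c) b.1 * h b.2 t) ->
  Ck k U f -> forall m, Ck k U (h m \o f).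
Proof.
move=> oU dh hE; elim: k f => [|k IH] f Cf m.
  move=> x Ux; apply: continuous_comp; first exact: Cf.
  by apply: differentiable_continuous; apply/derivable1_diffP; exact: dh.
have [df Df] := Cf; have {}dh m' t : differentiable (h m') t.
  by apply/derivable1_diffP; exact: dh.
split=> [x Ux|v]; first exact: differentiable_comp (df x Ux) (dh _ _).
have [c cE] := hE m.
(* Each [h b.2 \o f] is of class C^k by the induction hypothesis, which covers all indices at
   once. *)
have C : Ck k U (fun x => \sum_(b <- c) b.1 * h b.2 (f x)).
  elim: c {cE} => [|b c IHc].
    apply: (Ck_eq oU _ (Ck_cst k U 0)) => x _; by rewrite big_nil.
  apply: (Ck_eq oU _ (CkD oU (CkM oU (Ck_cst k U b.1)
    (IH _ (Ck_pred Cf) b.2)) IHc)) => x _.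
  by rewrite big_cons.
apply: (Ck_eq oU _ (CkM oU C (Df v))) => x Ux; have dx := df x Ux.
rewrite (deriveE v (differentiable_comp dx (dh m (f x)))).
rewrite diff_comp //= -cE (deriveE _ (dh m (f x))) (deriveE v dx).
by rewrite -[in RHS](mulr1 ('d f x v)) [RHS]linearZ mulrC.
Qed.

End SmoothFunctions.

(** * A smooth function on the line that vanishes for t <= 0 *)

Section FlatFunction.
Context (R : realType).

(* [flat_fun 0] is exp(-1/t) extended by 0; its derivatives are linear
   combinations of the other [flat_fun m]. *)
Definition flat_fun (m : nat) (t : R) : R :=
  if 0 < t then t^-1 ^+ m * expR (- t^-1) else 0.

(** With s = 1/t, the inequality exp(s) >= s^(m+2) / (m+2)! gives s^m exp(-s) <= (m+2)! s^-2. A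
    bound by t^2 is what makes the derivative at 0 vanish. *)
Lemma flat_fun_bound m t : `|flat_fun m t| <= (m.+2)`!%:R * t ^+ 2.
Proof.
rewrite /flat_fun; case: ifPn => [t0|_]; last first.
  by rewrite normr0 mulr_ge0 // sqr_ge0.
have s0 : 0 < t^-1 by rewrite invr_gt0.
rewrite ger0_norm ?mulr_ge0 ?expR_ge0 ?exprn_ge0 ?(ltW s0) //.
have le := expR_ge1Dxn m.+1 (ltW s0).
have fact0 : 0 < (m.+2)`!%:R :> R by rewrite ltr0n fact_gt0.
rewrite expRN ler_pdivrMr ?expR_gt0 //.
have E : t^-1 ^+ m = (m.+2)`!%:R * t ^+ 2 * (t^-1 ^+ m.+2 / (m.+2)`!%:R).
  have -> : t^-1 ^+ m.+2 = t^-1 ^+ m * t^-1 ^+ 2 by rewrite -exprD addn2.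
  by field; rewrite !gt_eqF.
rewrite {1}E ler_wpM2l ?mulr_ge0 ?(ltW t0) ?(ltW fact0) //.
by apply: le_trans le; rewrite lerDr.
Qed.

Lemma is_derive_quadratic (f : R -> R) (C : R) :
  (forall t, `|f t| <= C * t ^+ 2) -> is_derive (0 : R) (1 : R) f 0.
Proof.
move=> fC.
have f0 : f 0 = 0.
  by apply/normr0_eq0/eqP; rewrite eq_le normr_ge0 (le_trans (fC 0)) ?expr0n ?mulr0.
have C0 : 0 <= C by have := le_trans (normr_ge0 _) (fC 1); rewrite expr1n mulr1.
have lim0 : (fun h => h^-1 *: ((f \o shift 0) (h *: (1 : R)) - f 0)) @ 0^' --> (0 : R).
  apply/cvgr0Pnorm_le => e e0; near=> h.
  have h0 : h != 0 by near: h; exact: nbhs_dnbhs_neq.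
  rewrite /= addr0 f0 subr0 /GRing.scale /= mulr1 normrM normfV.
  rewrite ler_pdivrMl ?normr_gt0 //; apply: le_trans (fC h) _.
  rewrite -real_normK ?num_real // expr2 mulrA mulrC ler_wpM2l ?normr_ge0 //.
  (* Dividing by [C + 1] avoids the case [C = 0]. *)
  apply: (@le_trans _ _ (C * (e / (C + 1)))).
    rewrite ler_wpM2l //; near: h; apply: dnbhs0_le.
    by rewrite divr_gt0 // ltr_wpDl.
  by rewrite mulrCA ler_piMr ?(ltW e0) // ler_pdivrMr ?ltr_wpDl // mul1r lerDl.
apply: DeriveDef; first by apply/cvg_ex; exists 0.
by rewrite /derive; exact: cvg_lim.
Unshelve. all: by end_near. Qed.

(** For t < 0 the function is locally zero, for t > 0 this is the product rule, and at 0 both sides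
    vanish by the quadratic bound. *)
Lemma is_derive_flat_fun (m : nat) (t : R) :
  is_derive (t : R) (1 : R) (flat_fun m) (flat_fun m.+2 t - m%:R * flat_fun m.+1 t).
Proof.
have [t0|t0|->] := ltgtP t 0.
- have -> : flat_fun m.+2 t - m%:R * flat_fun m.+1 t = 0.
    by rewrite /flat_fun !(ltNge 0 t) (ltW t0) /= mulr0 subr0.
  have nE : \near t, cst 0 t = flat_fun m t.
    near=> u; rewrite /flat_fun ltNge; suff -> : u <= 0 by [].
    by near: u; apply: lt_le_nbhsl.
  exact: near_eq_is_derive nE (is_derive_cst _ _ _).
- have nE : \near t, t^-1 ^+ m * expR (- t^-1) = flat_fun m t.
    near=> u; rewrite /flat_fun; suff -> : 0 < u by [].
    by near: u; exact: lt_nbhsr.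
  apply: near_eq_is_derive nE _.
  have tn0 : t != 0 by rewrite gt_eqF.
  have dV : is_derive (t : R) (1 : R) (fun u : R => u^-1) (- t ^- 2).
    have := is_deriveV (f := id) tn0 (is_derive_id (t : R) (1 : R)).
    by rewrite /GRing.scale /= mulr1.
  have dX : is_derive (t : R) (1 : R) (fun u : R => u^-1 ^+ m)
      (m%:R * t^-1 ^+ m.-1 * - t ^- 2).
    have := is_deriveX m dV; rewrite /GRing.scale /=.
    by have -> : (fun u : R => u^-1) ^+ m = (fun u : R => u^-1 ^+ m)
      by apply: funext => u; rewrite exprfctE.
  have dE : is_derive (t : R) (1 : R) (expR \o (fun u : R => - u^-1))
      (expR (- t^-1) * t ^- 2).
    have dN : is_derive (t : R) (1 : R) (fun u : R => - u^-1) (t ^- 2).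
      by have := is_deriveN dV; rewrite opprK.
    exact: is_derive1_comp (is_derive_expR _) dN.
  have := is_deriveM dX dE; rewrite /GRing.scale /= => H.
  apply: (is_derive_eq H); rewrite /flat_fun t0 -exprVn.
  by case: m {dX H} => [|m] /=; rewrite ?exprS; ring.
- rewrite /flat_fun ltxx mulr0 subr0; exact: is_derive_quadratic (flat_fun_bound m).
Unshelve. all: by end_near. Qed.

Lemma Ck_flat_fun n k (U : set 'rV[R]_n) f :
  open U -> Ck k U f -> Ck k U (fun x => flat_fun 0 (f x)).
Proof.
move=> oU Cf; apply: (@Ck_comp _ _ _ _ _ flat_fun oU _ _ Cf 0) => [m t|m].
  by have [] := is_derive_flat_fun m t.
exists [:: (1, m.+2); (- m%:R, m.+1)] => t.
have [_ ->] := is_derive_flat_fun m t.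
by rewrite big_cons big_seq1 /= mul1r mulNr.
Qed.

End FlatFunction.

(** * Smooth functions on a manifold, bump functions and cutoffs *)

Section ManifoldFunctions.
Context (R : realType) (n : nat) (M : manifold R n).
Implicit Types (U V : set M) (f g : M -> R) (c : chart R n M).

(** Inside the open chart image, the image of [U] is its preimage under [cinv], which is continuous
    there. *)
Lemma chart_image_open c U : open U -> open (cmap c @` (cdom c `&` U)).
Proof.
move=> oU; rewrite openE => _ [x [cx Ux] <-].
have Wx : (cmap c @` cdom c) (cmap c x) by exists x.
have nU : nbhs (cmap c x) (cinv c @^-1` U).
  apply: (cinv_continuous Wx); rewrite (cmapK cx).
  exact: open_nbhs_nbhs.
have nW := open_nbhs_nbhs (conj (@cimg_open _ _ _ c) Wx).
apply: filterS2 nU nW => y Uy [z cz zy].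
by exists z => //; split=> //; move: Uy; rewrite -zy /= (cmapK cz).
Qed.

Lemma smooth_fun_sub U V f : V `<=` U -> smooth_fun U f -> smooth_fun V f.
Proof.
move=> VU sf c ac k; apply: Ck_sub (sf c ac k).
by apply: image_subset => x [cx /VU].
Qed.

Lemma smooth_fun_local U f :
  (forall x, U x -> exists2 V, V x & smooth_fun V f) -> smooth_fun U f.
Proof.
move=> H c ac k; apply: Ck_local => _ [x [cx Ux] <-].
have [V Vx sV] := H x Ux.
by exists (cmap c @` (cdom c `&` V)); [exists x|exact: sV].
Qed.

Lemma smooth_fun_eq U f g :
  open U -> (forall x, U x -> f x = g x) -> smooth_fun U f -> smooth_fun U g.
Proof.
move=> oU fg sf c ac k; apply: Ck_eq (sf c ac k); first exact: chart_image_open.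
by move=> _ [x [cx Ux] <-] /=; rewrite (cmapK cx) fg.
Qed.

Lemma smooth_fun_cst U (a : R) : smooth_fun U (fun _ => a).
Proof. by move=> c ac k; apply: Ck_cst. Qed.

Lemma smooth_funD U f g : open U ->
  smooth_fun U f -> smooth_fun U g -> smooth_fun U (fun x => f x + g x).
Proof.
move=> oU sf sg c ac k; apply: CkD; first exact: chart_image_open.
  exact: sf.
exact: sg.
Qed.

Lemma smooth_funM U f g : open U ->
  smooth_fun U f -> smooth_fun U g -> smooth_fun U (fun x => f x * g x).
Proof.
move=> oU sf sg c ac k; apply: CkM; first exact: chart_image_open.
  exact: sf.
exact: sg.
Qed.

Lemma smooth_funN U f : open U ->
  smooth_fun U f -> smooth_fun U (fun x => - f x).
Proof.
move=> oU sf; apply: (smooth_fun_eq oU _ (smooth_funM oU (smooth_fun_cst U (-1)) sf)).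
by move=> x _; rewrite mulN1r.
Qed.

Lemma smooth_funV U f : open U -> (forall x, U x -> f x != 0) ->
  smooth_fun U f -> smooth_fun U (fun x => (f x)^-1).
Proof.
move=> oU f0 sf c ac k; apply: CkV; first exact: chart_image_open.
  by move=> _ [x [cx Ux] <-] /=; rewrite (cmapK cx) f0.
exact: sf.
Qed.

Lemma smooth_fun_sum U (I : Type) (s : seq I) (F : I -> M -> R) : open U ->
  (forall i, smooth_fun U (F i)) -> smooth_fun U (fun x => \sum_(i <- s) F i x).
Proof.
move=> oU sF; elim: s => [|i s IH].
  by apply: (smooth_fun_eq oU _ (smooth_fun_cst U 0)) => x _; rewrite big_nil.
by apply: (smooth_fun_eq oU _ (smooth_funD oU (sF i) IH)) => x _; rewrite big_cons.
Qed.

Lemma smooth_flat_fun U f : open U ->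
  smooth_fun U f -> smooth_fun U (fun x => flat_fun 0 (f x)).
Proof.
move=> oU sf c ac k; apply: (@Ck_flat_fun _ _ _ _ (f \o cinv c)).
  exact: chart_image_open.
exact: sf.
Qed.

Lemma smooth_chart_coord c j :
  atlas M c -> smooth_fun (cdom c) (fun x => cmap c x 0 j).
Proof. by move=> ac c' ac' k; apply: atlas_compat. Qed.

Lemma smooth_fun_continuous U f x :
  open U -> smooth_fun U f -> U x -> {for x, continuous f}.
Proof.
move=> oU sf Ux; have [c ac cx] := atlas_cover x.
have imx : (cmap c @` (cdom c `&` U)) (cmap c x) by exists x.
have cf : {for x, continuous (f \o cinv c \o cmap c)}.
  by apply: continuous_comp; [exact: cmap_continuous|exact: (sf c ac 0 _ imx)].
have nE : \near x, f x = (f \o cinv c \o cmap c) x.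
  apply: filterS (open_nbhs_nbhs (conj (@cdom_open _ _ _ c) cx)) => y cy.
  by rewrite /= cmapK.
rewrite /prop_for /continuous_at (nbhs_singleton nE).
by apply: cvg_trans cf; apply: (near_eq_cvg _); apply: filterS nE => y ->.
Qed.

(* The bump function is supported in a chart, on the preimage of a small
   compact cube, which is closed in [M] because [M] is Hausdorff. *)
Lemma bump_function U x0 : open U -> U x0 ->
  exists (psi : M -> R) (K : set M),
    [/\ Cinf M psi, psi x0 = 1, closed K, K `<=` U &
        forall x, ~ K x -> psi x = 0].
Proof.
move=> oU Ux0; have [c ac cx0] := atlas_cover x0.
set W := cmap c @` (cdom c `&` U); set y0 := cmap c x0.
have Wy0 : W y0 by exists x0.
have /nbhs_ballP[e /= e0 eW] := open_nbhs_nbhs (conj (chart_image_open (c := c) oU) Wy0).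
(* Half the radius keeps the closed cube of half-side [d] inside the ball contained in [W]. *)
set d := e / 2; have d0 : 0 < d by rewrite divr_gt0.
pose K0 : set 'rV[R]_n := [set v | forall j, `[y0 0 j - d, y0 0 j + d]%classic (v 0 j)].
have cK0 : compact K0.
  apply: (@rV_compact _ _ (fun j => `[y0 0 j - d, y0 0 j + d]%classic)) => j.
  exact: segment_compact.
have K0W : K0 `<=` W.
  move=> v Kv; apply: eW; split=> // i j; rewrite (ord1 i) /ball /=.
  have := Kv j; rewrite /= in_itv /= => /andP[h1 h2].
  have d_e : d < e by rewrite /d; lra.
  by rewrite ltr_norml; apply/andP; split; lra.
(* [q] is positive only at Euclidean distance less than [d] from [y0] in coordinates, hence inside
   the cube; [flat_fun 0 (q x)] vanishes off the cube, and dividing by its value at [x0] normalises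
   it. *)
pose q x := d ^+ 2 - \sum_j (cmap c x 0 j - y0 0 j) ^+ 2.
have flat0 : 0 < flat_fun 0 (d ^+ 2).
  by rewrite /flat_fun exprn_gt0 // expr0 mul1r expR_gt0.
exists (fun x => if x \in cdom c then flat_fun 0 (q x) / flat_fun 0 (d ^+ 2) else 0).
have Kclosed : closed (cinv c @` K0).
  apply: compact_closed; first exact: mspace_hausdorff.
  apply: continuous_compact cK0; apply: continuous_in_subspaceT => y.
  rewrite inE => /K0W [x [cx _] <-]; apply: cinv_continuous; by exists x.
have supp x : ~ (cinv c @` K0) x ->
    (if x \in cdom c then flat_fun 0 (q x) / flat_fun 0 (d ^+ 2) else 0) = 0.
  move=> nK; case: ifPn => // /set_mem cx; rewrite /flat_fun ifF ?mul0r //.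
  apply/negbTE; rewrite -leNgt subr_le0.
  (* Off the cube a single coordinate already forces [q x <= 0]. *)
  have [j dj] : exists j, d < `|cmap c x 0 j - y0 0 j|.
    apply: contrapT => nj; apply: nK; exists (cmap c x); last exact: cmapK.
    move=> j; rewrite /= in_itv /=.
    have : `|cmap c x 0 j - y0 0 j| <= d.
      by rewrite leNgt; apply/negP => dj; apply: nj; exists j.
    by rewrite ler_norml => /andP[h1 h2]; apply/andP; split; lra.
  rewrite (bigD1 j) //= ler_wpDr ?sumr_ge0 // => [i _|]; first exact: sqr_ge0.
  by rewrite -[leRHS]real_normK ?num_real // lerXn2r ?nnegrE ?(ltW d0) ?normr_ge0 ?ltW.
exists (cinv c @` K0); split => //.
- apply: smooth_fun_local => x _.
  have [cx|ncx] := pselect (cdom c x).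
    exists (cdom c) => //; have ocd := @cdom_open _ _ _ c.
    have sq : smooth_fun (cdom c) q.
      apply: smooth_funD => //; first exact: smooth_fun_cst.
      apply: smooth_funN => //; apply: smooth_fun_sum => // j.
      have sj : smooth_fun (cdom c) (fun x => cmap c x 0 j - y0 0 j).
        by apply: smooth_funD => //; [exact: smooth_chart_coord|exact: smooth_fun_cst].
      exact: (smooth_funM ocd sj sj).
    apply: (smooth_fun_eq ocd _ (smooth_funM ocd (smooth_flat_fun ocd sq)
      (smooth_fun_cst _ (flat_fun 0 (d ^+ 2))^-1))) => z cz.
    by rewrite (mem_set cz).
  have oK : open (~` (cinv c @` K0)) by exact: closed_openC.
  exists (~` (cinv c @` K0)).
    by move=> [v /K0W [z [cz _] <-]]; rewrite cmapK // => zx; apply: ncx; rewrite -zx.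
  by apply: (smooth_fun_eq oK _ (smooth_fun_cst _ 0)) => z /supp ->.
- rewrite (mem_set cx0) /q big1 ?subr0 ?divff ?gt_eqF // => j _.
  by rewrite subrr expr0n.
- by move=> _ [v /K0W [z [cz Uz] <-] <-]; rewrite cmapK.
Qed.

Lemma Cinf_cst (a : R) : Cinf M (fun _ => a).
Proof. exact: smooth_fun_cst. Qed.

Lemma CinfD f g : Cinf M f -> Cinf M g -> Cinf M (fun x => f x + g x).
Proof. exact: smooth_funD openT. Qed.

Lemma CinfM f g : Cinf M f -> Cinf M g -> Cinf M (fun x => f x * g x).
Proof. exact: smooth_funM openT. Qed.

Lemma CinfN f : Cinf M f -> Cinf M (fun x => - f x).
Proof. exact: smooth_funN openT. Qed.

(** Near a point of [K] this is a product of smooth functions; the complement of [K] is open and the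
    product is zero there. *)
Lemma smooth_fun_cutoff U W K psi f : open U -> open W -> closed K ->
  K `<=` U -> (forall x, ~ K x -> psi x = 0) -> Cinf M psi ->
  smooth_fun (W `&` U) f -> smooth_fun W (fun x => psi x * f x).
Proof.
move=> oU oW cK KU psi0 spsi sf; apply: smooth_fun_local => x Wx.
have [Kx|nKx] := pselect (K x).
  exists (W `&` U); first by split=> //; exact: KU.
  by apply: smooth_funM => //; [exact: openI|exact: smooth_fun_sub spsi].
have oK : open (~` K) by exact: closed_openC.
exists (~` K) => //; apply: (smooth_fun_eq oK _ (smooth_fun_cst _ 0)) => z Kz.
by rewrite psi0 ?mul0r.
Qed.

End ManifoldFunctions.

(** * Sections of vector bundles *)

Section SmoothSections.
Context (R : realType) (n : nat) (M : manifold R n).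
Context (r : nat) (E : vbundle M r).
Implicit Types (X Y : rsec E) (U V : set M) (f : M -> R).

Lemma rsecP X Y : (forall x, X x = Y x) -> X = Y.
Proof. exact: functional_extensionality_dep. Qed.

Lemma Gamma_eq X Y : (forall x, X x = Y x) -> Gamma E X -> Gamma E Y.
Proof. by move=> /rsecP ->. Qed.

Lemma frame_expand (t : trivialisation E r) x (u : E x) :
  tdom t x -> u = \sum_i tmap t u 0 i *: frame t i x.
Proof.
move=> tx; rewrite -[LHS](tmapK tx u) [in LHS](row_sum_delta (tmap t u)).
by rewrite linear_sum; apply: eq_bigr => i _; rewrite linearZ.
Qed.

Lemma smooth_sec_sub U V X : V `<=` U -> smooth_sec_on U X -> smooth_sec_on V X.
Proof.
move=> VU sX t tt j; apply: smooth_fun_sub (sX t tt j) => x [tx Vx].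
by split=> //; exact: VU.
Qed.

Lemma smooth_frame t i : trivs E t -> smooth_sec_on (tdom t) (frame t i).
Proof. by move=> tt t' tt' j; rewrite setIC; exact: trivs_compat. Qed.

Lemma smooth_sec_coord U X t j : trivs E t -> smooth_sec_on U X ->
  U `<=` tdom t -> smooth_fun U (fun x => tmap t (X x) 0 j).
Proof.
move=> tt sX Ut; apply: smooth_fun_sub (sX t tt j) => x Ux.
by split=> //; exact: Ut.
Qed.

Lemma smooth_sec0 U : smooth_sec_on U (fun x => 0 : E x).
Proof.
move=> t tt j; have -> : (fun x => tmap t (0 : E x) 0 j) = (fun=> 0).
  by apply: funext => x; rewrite linear0 mxE.
exact: smooth_fun_cst.
Qed.

Lemma Gamma0 : Gamma E (fun x => 0).
Proof. exact: smooth_sec0. Qed.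

Lemma GammaL f X Y : Cinf M f -> Gamma E X -> Gamma E Y ->
  Gamma E (fun x => f x *: X x + Y x).
Proof.
move=> sf sX sY t tt j.
have oT : open (tdom t `&` setT) by apply: openI; [exact: tdom_open|exact: openT].
apply: (smooth_fun_eq oT _ (smooth_funD oT (smooth_funM oT
  (smooth_fun_sub _ sf) (sX t tt j)) (sY t tt j))) => // x _.
by rewrite linearP !mxE.
Qed.

Lemma GammaZ f X : Cinf M f -> Gamma E X -> Gamma E (fun x => f x *: X x).
Proof.
move=> sf sX; apply: Gamma_eq (GammaL sf sX Gamma0) => x.
by rewrite addr0.
Qed.

Lemma GammaD X Y : Gamma E X -> Gamma E Y -> Gamma E (fun x => X x + Y x).
Proof.
move=> sX sY; apply: Gamma_eq (GammaL (@Cinf_cst R n M 1) sX sY) => x.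
by rewrite scale1r.
Qed.

Lemma Gamma_sum (I : Type) (s : seq I) (F : I -> rsec E) :
  (forall i, Gamma E (F i)) -> Gamma E (fun x => \sum_(i <- s) F i x).
Proof.
move=> sF; elim: s => [|i s IH].
  by apply: Gamma_eq Gamma0 => x; rewrite big_nil.
by apply: Gamma_eq (GammaD (sF i) IH) => x; rewrite big_cons.
Qed.

Lemma Gamma_cutoff U K psi X : open U -> closed K -> K `<=` U ->
  (forall x, ~ K x -> psi x = 0) -> Cinf M psi -> smooth_sec_on U X ->
  Gamma E (fun x => psi x *: X x).
Proof.
move=> oU cK KU psi0 spsi sX t tt j; rewrite setIT.
have -> : (fun x => tmap t (psi x *: X x) 0 j) =
    (fun x => psi x * tmap t (X x) 0 j).
  by apply: funext => x; rewrite linearZ mxE.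
exact: smooth_fun_cutoff oU (tdom_open t) cK KU psi0 spsi (sX t tt j).
Qed.

(** A bump function makes global the combination of frame sections with the coordinates of [u].
    Pointwise identities can thus be tested on global sections. *)
Lemma section_through x (u : E x) : exists2 Z, Gamma E Z & Z x = u.
Proof.
have [t tt tx] := trivs_cover E x.
have [psi [K [spsi psi1 cK KU psi0]]] := bump_function (tdom_open t) tx.
exists (fun y => \sum_i tmap t u 0 i *: (psi y *: frame t i y)).
  apply: Gamma_sum => i; apply: GammaZ; first exact: Cinf_cst.
  exact: Gamma_cutoff (tdom_open t) cK KU psi0 spsi (smooth_frame i tt).
rewrite [RHS](frame_expand _ tx); apply: eq_bigr => i _.
by rewrite psi1 scale1r.
Qed.

Lemma bundle_map_smooth (r' : nat) (F : vbundle M r')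
    (h : forall x, 'Hom(E x, F x)) U X : open U -> bundle_map h ->
  smooth_sec_on U X -> smooth_sec_on U (fun x => h x (X x) : F x).
Proof.
move=> oU sh sX t tt j; apply: smooth_fun_local => x [tx Ux].
have [t' tt' t'x] := trivs_cover E x.
exists (tdom t' `&` tdom t `&` U) => //.
have oW : open (tdom t' `&` tdom t `&` U).
  by do !apply: openI => //; exact: tdom_open.
have sW : smooth_fun (tdom t' `&` tdom t `&` U)
    (fun x => \sum_i tmap t' (X x) 0 i * tmap t (h x (frame t' i x) : F x) 0 j).
  apply: smooth_fun_sum => // i; apply: smooth_funM => //.
    by apply: smooth_fun_sub (sX t' tt' i) => y [[]].
  by apply: smooth_fun_sub (sh t' t tt' tt i j) => y [].
apply: (smooth_fun_eq oW _ sW) => y [[t'y _] _].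
rewrite [in RHS](frame_expand (X y) t'y) !linear_sum summxE.
by apply: eq_bigr => i _; rewrite !linearZ mxE.
Qed.

Lemma pairing_smooth U (xi : rsec (dualb E)) X : open U ->
  smooth_sec_on U xi -> smooth_sec_on U X ->
  smooth_fun U (fun x => pairing (xi x) (X x)).
Proof.
move=> oU sxi sX; apply: smooth_fun_local => x Ux.
have [t tt tx] := trivs_cover E x; exists (tdom t `&` U) => //.
have oW : open (tdom t `&` U) by apply: openI => //; exact: tdom_open.
have dt : trivs (dualb E) (dtriv t) by exists t.
have sW : smooth_fun (tdom t `&` U)
    (fun x => \sum_i tmap t (X x) 0 i * tmap (dtriv t) (xi x) 0 i).
  apply: smooth_fun_sum => // i.
  exact: (smooth_funM oW (sX t tt i) (sxi (dtriv t) dt i)).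
apply: (smooth_fun_eq oW _ sW) => y [ty _].
rewrite /pairing [in RHS](frame_expand (X y) ty) linear_sum.
by apply: eq_bigr => i _; rewrite linearZ /= dtmapE.
Qed.

End SmoothSections.

(** * Pairings, and dual sections from tensorial functionals *)

Section DualSections.
Context (R : realType) (n : nat) (M : manifold R n).
Context (r : nat) (E : vbundle M r).
Implicit Types (X Y : rsec E) (U V : set M) (f : M -> R).

Lemma pairingDr x (xi : dualb E x) (u v : E x) :
  pairing xi (u + v) = pairing xi u + pairing xi v.
Proof. exact: linearD. Qed.

Lemma pairingZr x (xi : dualb E x) a (u : E x) :
  pairing xi (a *: u) = a * pairing xi u.
Proof. exact: linearZ. Qed.

Lemma pairingNr x (xi : dualb E x) (u : E x) : pairing xi (- u) = - pairing xi u.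
Proof. exact: linearN. Qed.

Lemma pairing0r x (xi : dualb E x) : pairing xi 0 = 0.
Proof. exact: linear0. Qed.

Lemma pairing_sumr x (xi : dualb E x) (I : Type) (s : seq I) (F : I -> E x) :
  pairing xi (\sum_(i <- s) F i) = \sum_(i <- s) pairing xi (F i).
Proof. exact: linear_sum. Qed.

Lemma pairingDl x (xi eta : dualb E x) (u : E x) :
  pairing (xi + eta) u = pairing xi u + pairing eta u.
Proof. exact: add_lfunE. Qed.

Lemma pairingZl x (xi : dualb E x) a (u : E x) :
  pairing (a *: xi) u = a * pairing xi u.
Proof. exact: scale_lfunE. Qed.

Lemma pairingNl x (xi : dualb E x) (u : E x) : pairing (- xi) u = - pairing xi u.
Proof. exact: opp_lfunE. Qed.

Lemma pairing0l x (u : E x) : pairing (0 : dualb E x) u = 0.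
Proof. exact: zero_lfunE. Qed.

Lemma pairing_inj x (xi eta : dualb E x) :
  (forall u, pairing xi u = pairing eta u) -> xi = eta.
Proof. by move=> H; apply/lfunP => u; exact: H. Qed.

Lemma pairing_frame_dual (t : trivialisation E r) x i (u : E x) :
  pairing (frame (dtriv t) i x : dualb E x) u = tmap t u 0 i.
Proof.
rewrite /pairing /frame /= dtinvE (bigD1 i) //= mxE !eqxx mul1r big1 ?addr0 // => k ki.
by rewrite mxE (negbTE ki) andbF mul0r.
Qed.

Lemma dual_separates x (u : E x) :
  (forall xi, Gamma (dualb E) xi -> pairing (xi x) u = 0) -> u = 0.
Proof.
move=> H; have [t tt tx] := trivs_cover E x.
rewrite (frame_expand u tx) big1 // => i _; rewrite -pairing_frame_dual.
have [xi sxi <-] := section_through (frame (dtriv t) i x : dualb E x).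
by rewrite H // scale0r.
Qed.

Lemma separates x (xi : dualb E x) :
  (forall X, Gamma E X -> pairing xi (X x) = 0) -> xi = 0.
Proof.
move=> H; apply: pairing_inj => u; rewrite pairing0l.
by have [Z sZ <-] := section_through u; exact: H.
Qed.

Lemma dframe_expand (t : trivialisation E r) x (xi : dualb E x) : tdom t x ->
  xi = \sum_i pairing xi (frame t i x) *: frame (dtriv t) i x.
Proof.
move=> tx; rewrite [LHS](@frame_expand _ _ _ _ (dualb E) (dtriv t)) //.
by apply: eq_bigr => i _; rewrite /= dtmapE.
Qed.

(** Linearity over smooth functions makes [c X x] depend on [X x] alone, so [c] defines a covector
    at each point, and evaluation on cut-off frames shows that it varies smoothly. *)
Lemma tensorial_section (c : rsec E -> M -> R) :
  (forall X, Gamma E X -> Cinf M (c X)) ->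
  (forall f X Y, Cinf M f -> Gamma E X -> Gamma E Y ->
    forall x, c (fun y => f y *: X y + Y y) x = f x * c X x + c Y x) ->
  exists2 zeta, Gamma (dualb E) zeta &
    forall X, Gamma E X -> forall x, pairing (zeta x) (X x) = c X x.
Proof.
move=> sc lc.
have sec0 := @Gamma0 _ _ _ _ E.
have c0 x : c (fun=> 0) x = 0.
  have := lc _ _ _ (@Cinf_cst R n M 1) sec0 sec0 x.
  rewrite (_ : (fun y => 1 *: 0 + 0) = (fun y => 0 : E y)); last first.
    by apply: rsecP => y; rewrite scaler0 addr0.
  by rewrite mul1r => /eqP; rewrite -subr_eq subrr eq_sym => /eqP.
have cZ f X x : Cinf M f -> Gamma E X -> c (fun y => f y *: X y) x = f x * c X x.
  move=> sf sX; have := lc f X _ sf sX sec0 x; rewrite c0 addr0 => <-.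
  by congr (c _ x); apply: rsecP => y; rewrite addr0.
have cD X Y x : Gamma E X -> Gamma E Y -> c (fun y => X y + Y y) x = c X x + c Y x.
  move=> sX sY; have := lc _ X Y (@Cinf_cst R n M 1) sX sY x; rewrite mul1r => <-.
  by congr (c _ x); apply: rsecP => y; rewrite scale1r.
have c_sum (I : Type) (s : seq I) (F : I -> rsec E) x : (forall i, Gamma E (F i)) ->
    c (fun y => \sum_(i <- s) F i y) x = \sum_(i <- s) c (F i) x.
  move=> sF; elim: s => [|i s IH].
    by rewrite big_nil -[RHS](c0 x); congr (c _ x); apply: rsecP => y; rewrite big_nil.
  rewrite big_cons -IH -cD //; last exact: Gamma_sum.
  by congr (c _ x); apply: rsecP => y; rewrite big_cons.
(* Write psi^2 X as a combination of the global sections psi e_i with the global coefficients psi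
   X^i, which vanish at [x] when [X] does. *)
have c_loc X x : Gamma E X -> X x = 0 -> c X x = 0.
  move=> sX X0; have [t tt tx] := trivs_cover E x.
  have [psi [K [spsi psi1 cK KU psi0]]] := bump_function (tdom_open t) tx.
  have sF i : Gamma E (fun y => psi y *: frame t i y).
    exact: Gamma_cutoff (tdom_open t) cK KU psi0 spsi (smooth_frame i tt).
  have sf i : Cinf M (fun y => psi y * tmap t (X y) 0 i).
    apply: (smooth_fun_cutoff (tdom_open t) openT cK KU psi0 spsi).
    by rewrite setTI; apply: smooth_sec_coord tt (smooth_sec_sub _ sX) _.
  have -> : c X x = c (fun y => (psi y * psi y) *: X y) x.
    by rewrite (@cZ (fun y => psi y * psi y)) ?psi1 ?mul1r //; exact: CinfM.
  rewrite (_ : (fun y => _) = (fun y =>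
      \sum_i (psi y * tmap t (X y) 0 i) *: (psi y *: frame t i y))).
    rewrite (@c_sum _ _ (fun i y =>
      (psi y * tmap t (X y) 0 i) *: (psi y *: frame t i y))).
      rewrite big1 // => i _; rewrite (@cZ (fun y => psi y * tmap t (X y) 0 i)) //.
      by rewrite X0 linear0 mxE mulr0 mul0r.
    by move=> i; exact: GammaZ.
  apply: rsecP => y; have [Ky|nKy] := pselect (K y); last first.
    by rewrite psi0 // !mul0r scale0r big1 // => i _; rewrite mul0r scale0r.
  rewrite [X in _ *: X](frame_expand (X y) (KU _ Ky)) scaler_sumr.
  by apply: eq_bigr => i _; rewrite !scalerA; congr (_ *: _); ring.
have c_pt X Y x : Gamma E X -> Gamma E Y -> X x = Y x -> c X x = c Y x.
  move=> sX sY XY; apply/eqP; rewrite -subr_eq0 -mulN1r addrC.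
  rewrite -(lc _ _ _ (@Cinf_cst R n M (-1)) sY sX) c_loc //; last first.
    by rewrite XY scaleN1r addNr.
  exact: (GammaL (@Cinf_cst R n M (-1)) sY sX).
(* A section through each vector is chosen; by [c_pt] the value of [c] does not depend on the
   choice. *)
pose sec x (u : E x) := s2val (cid2 (section_through u)).
have sec_s x u : Gamma E (@sec x u) by rewrite /sec; case: cid2.
have sec_x x u : @sec x u x = u by rewrite /sec; case: cid2.
pose zeta : rsec (dualb E) := fun x => linfun (fun u : E x => (c (sec x u) x : R^o)).
have zetaE x u : pairing (zeta x) u = c (sec x u) x.
  rewrite /pairing /zeta linfunE // => a v v'.
  rewrite -[RHS](lc _ _ _ (@Cinf_cst R n M a)) //; apply: c_pt => //.
    exact: (GammaL (@Cinf_cst R n M a)).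
  by rewrite !sec_x.
have zetaP X : Gamma E X -> forall x, pairing (zeta x) (X x) = c X x.
  by move=> sX x; rewrite zetaE; apply: c_pt.
exists zeta => // _ [t tt <-] j; apply: smooth_fun_local => x [tx _].
have [psi [K [spsi psi1 cK KU psi0]]] := bump_function (tdom_open t) tx.
have sF : Gamma E (fun y => psi y *: frame t j y).
  exact: Gamma_cutoff (tdom_open t) cK KU psi0 spsi (smooth_frame j tt).
(* Where [psi] is nonzero, a coordinate of [zeta] is the value of [c] on the cut-off frame section
   divided by [psi]. *)
pose V := psi @^-1` (~` [set 0]).
have oV : open V.
  apply: open_comp.
    by move=> y _; apply: smooth_fun_continuous openT spsi _.
  exact/closed_openC/closed_eq.
exists V; first by rewrite /V /= psi1; apply/eqP; exact: oner_neq0.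
have sV : smooth_fun V (fun y => c (fun y => psi y *: frame t j y) y * (psi y)^-1).
  apply: smooth_funM => //; first exact: smooth_fun_sub (sc _ sF).
  apply: smooth_funV => //; first by move=> y /eqP.
  exact: smooth_fun_sub spsi.
apply: (smooth_fun_eq oV _ sV) => y Vy.
rewrite -zetaP // pairingZr /= dtmapE mulrAC mulfV ?mul1r //.
exact/eqP.
Qed.

End DualSections.

(** * Two-forms on a vector bundle *)

Section TwoForms.
Context (R : realType) (n : nat) (M : manifold R n).
Context (r : nat) (E : vbundle M r).
Implicit Types (X Y : rsec E) (U V : set M) (w : rform E).

Lemma kform2Dl w x (u v z : E x) : kform 2 w -> w x [:: u + v; z] = w x [:: u; z] + w x [:: v; z].
Proof. by move=> kw; rewrite -!(flatE _ _ kw) linearD pairingDl. Qed.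

Lemma kform2Zl w x a (u z : E x) : kform 2 w -> w x [:: a *: u; z] = a * w x [:: u; z].
Proof. by move=> kw; rewrite -!(flatE _ _ kw) linearZ pairingZl. Qed.

Lemma kform2Dr w x (u v z : E x) : kform 2 w -> w x [:: z; u + v] = w x [:: z; u] + w x [:: z; v].
Proof. by move=> kw; rewrite -!(flatE _ _ kw) pairingDr. Qed.

Lemma kform2Zr w x a (u z : E x) : kform 2 w -> w x [:: z; a *: u] = a * w x [:: z; u].
Proof. by move=> kw; rewrite -!(flatE _ _ kw) pairingZr. Qed.

Lemma kform2_suml w x (I : Type) (s : seq I) (F : I -> E x) z : kform 2 w ->
  w x [:: \sum_(i <- s) F i; z] = \sum_(i <- s) w x [:: F i; z].
Proof.
move=> kw; rewrite -(flatE _ _ kw) linear_sum /pairing sum_lfunE.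
by apply: eq_bigr => i _; rewrite -(flatE _ _ kw).
Qed.

Lemma kform2_sumr w x (I : Type) (s : seq I) (F : I -> E x) z : kform 2 w ->
  w x [:: z; \sum_(i <- s) F i] = \sum_(i <- s) w x [:: z; F i].
Proof.
move=> kw; rewrite -(flatE _ _ kw) pairing_sumr.
by apply: eq_bigr => i _; rewrite -(flatE _ _ kw).
Qed.

Lemma kform2_alt w x (u : E x) : kform 2 w -> w x [:: u; u] = 0.
Proof. by move=> kw; exact: (kform_alternating kw [::] [::] [::]). Qed.

Lemma kform2_skew w x (u v : E x) : kform 2 w -> w x [:: u; v] = - w x [:: v; u].
Proof.
move=> kw; apply/eqP; rewrite -addr_eq0; have := kform2_alt (u + v) kw.
by rewrite kform2Dl // !kform2Dr // !kform2_alt // add0r addr0 => ->.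
Qed.


Lemma kform2_smooth w U X Y : kform 2 w -> open U ->
  smooth_sec_on U X -> smooth_sec_on U Y ->
  smooth_fun U (fun x => w x [:: X x; Y x]).
Proof.
move=> kw oU sX sY; apply: smooth_fun_local => x Ux.
have [t tt tx] := trivs_cover E x; exists (tdom t `&` U) => //.
have oW : open (tdom t `&` U) by apply: openI => //; exact: tdom_open.
have sW : smooth_fun (tdom t `&` U) (fun x => \sum_i \sum_j
    tmap t (X x) 0 i * (tmap t (Y x) 0 j * w x [:: frame t i x; frame t j x])).
  apply: smooth_fun_sum => // i; apply: smooth_fun_sum => // j.
  apply: (smooth_funM oW (sX t tt i)); apply: (smooth_funM oW (sY t tt j)).
  by apply: smooth_fun_sub (kform_smooth kw tt [:: i; j]) => y [].
apply: (smooth_fun_eq oW _ sW) => y [ty _].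
rewrite [in RHS](frame_expand (X y) ty) [in RHS](frame_expand (Y y) ty).
rewrite kform2_suml //; apply: eq_bigr => i _.
rewrite kform2_sumr //; apply: eq_bigr => j _.
by rewrite kform2Zl // kform2Zr //.
Qed.

Lemma flat_smooth w U X : kform 2 w -> open U -> smooth_sec_on U X ->
  smooth_sec_on U (fun x => flat w x (X x) : dualb E x).
Proof.
move=> kw oU sX _ [t tt <-] j.
have oW : open (tdom t `&` U) by apply: openI => //; exact: tdom_open.
have sW : smooth_fun (tdom t `&` U) (fun x => w x [:: X x; frame t j x]).
  apply: kform2_smooth => //; first by apply: smooth_sec_sub sX => y [].
  by apply: smooth_sec_sub (smooth_frame j tt) => y [].
apply: (smooth_fun_eq oW _ sW) => y _.
by rewrite /= dtmapE -(flatE _ _ kw).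
Qed.

Lemma bilinear_kform2 (b : forall x, 'Hom(E x, dualb E x)) :
  (forall x (u : E x), pairing (b x u) u = 0) ->
  (forall t, trivs E t -> forall i,
     smooth_sec_on (tdom t) (fun x => b x (frame t i x))) ->
  kform 2 (fun x (s : seq (E x)) =>
    if s is [:: u; v] then pairing (b x u) v else 0).
Proof.
move=> alt sb; split.
- by move=> x [|u [|v [|z s]]].
- move=> x [|u1 [|u2 [|u3 s1]]] [|v1 [|v2 s2]] a u v;
    rewrite /= ?mulr0 ?addr0 //.
  + by rewrite linearP pairingDl pairingZl.
  + by rewrite pairingDr pairingZr.
- by move=> x [|u1 [|u2 [|u3 s1]]] [|v1 [|v2 s2]] [|z1 s3] u //=; exact: alt.
- move=> t tt [|i [|j [|k s]]] /=; try exact: smooth_fun_cst.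
  apply: pairing_smooth; first exact: tdom_open.
    exact: sb.
  exact: smooth_frame.
Qed.

End TwoForms.

(** * Graphs of skew maps as maximally isotropic subbundles *)

Section SharpAndSubbundles.
Context (R : realType) (n : nat) (M : manifold R n).
Context (r : nat) (A : vbundle M r).
Implicit Types (U : set M).

Lemma sharp_smooth (p : rmvec A) U (xi : rsec (dualb A)) : kmvec 2 p ->
  open U -> smooth_sec_on U xi ->
  smooth_sec_on U (fun x => sharp p x (xi x)).
Proof.
move=> kp oU sxi t tt j.
have oW : open (tdom t `&` U) by apply: openI => //; exact: tdom_open.
have dt : trivs (dualb A) (dtriv t) by exists t.
have sW : smooth_fun (tdom t `&` U)
    (fun x => p x [:: xi x; frame (dtriv t) j x : dualb A x]).
  apply: kform2_smooth => //; first by apply: smooth_sec_sub sxi => y [].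
  by apply: smooth_sec_sub (smooth_frame j dt) => y [].
apply: (smooth_fun_eq oW _ sW) => y _.
by rewrite -pairing_frame_dual sharpE.
Qed.


Lemma frame_basis (F : vbundle M r) (t : trivialisation F r) x : tdom t x ->
  basis_of fullv [seq frame t i x | i <- enum 'I_r].
Proof.
move=> tx; rewrite basisEdim; apply/andP; split.
  apply/subvP => u _; rewrite (frame_expand u tx) memv_suml // => i _.
  by apply: memvZ; apply: memv_span; apply: map_f; rewrite mem_enum.
rewrite size_map size_enum_ord.
(* Injectivity of the inverse trivialisation bounds the dimension of the fibre below by [r], so the
   spanning family of [r] vectors is a basis. *)
have inj : lker (tinv t : 'Hom('rV[R]_r, F x)) == 0%VS.
  by apply/lker0P; exact: can_inj (tinvK tx).
have dimV : \dim {:'rV[R]_r} = r by rewrite dimvf /dim /= mul1n.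
rewrite -[leqLHS]dimV -(limg_dim_eq (f := (tinv t : 'Hom('rV[R]_r, F x)))) ?dimvS ?subvf //.
by rewrite (eqP inj) capv0.
Qed.

(** The set is the image of an injective bundle map, which carries local frames to local frames.
    Taking [F] to be [A] or its dual covers graphs and cographs. *)
Lemma subbundle_range (F : vbundle M r) (f : forall x, F x -> A x)
    (g : forall x, F x -> dualb A x) :
  (forall x, linear (f x)) -> (forall x, linear (g x)) ->
  (forall U Z, open U -> smooth_sec_on U Z ->
     smooth_sec_on U (fun x => f x (Z x)) /\
     smooth_sec_on U (fun x => g x (Z x))) ->
  (forall x u, f x u = 0 -> g x u = 0 -> u = 0) ->
  subbundle (fun x => [set (f x u, g x u) | u in [set: F x]]).
Proof.
move=> lf lg sfg inj; exists r => x0; have [t tt tx0] := trivs_cover F x0.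
exists (tdom t), (fun i x => f x (frame t i x)), (fun i x => g x (frame t i x)).
pose h x : 'Hom(F x, (A x * dualb A x)%type) := linfun (fun u => (f x u, g x u)).
have hE x u : h x u = (f x u, g x u).
  by rewrite linfunE // => a y z; rewrite lf lg.
have eE x : [seq (f x (frame t i x), g x (frame t i x)) | i <- enum 'I_r] =
    [seq h x u | u <- [seq frame t i x | i <- enum 'I_r]].
  by elim: (enum 'I_r) => //= i s ->; rewrite hE.
have hb x : tdom t x -> basis_of (limg (h x))
    [seq h x u | u <- [seq frame t i x | i <- enum 'I_r]].
  move=> tx; apply: limg_basis_of (frame_basis tx); rewrite capfv.
  apply/eqP; rewrite -subv0; apply/subvP => u; rewrite memv_ker hE memv0.
  by move=> /eqP [fu gu]; apply/eqP; apply: inj.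
split=> //; first exact: tdom_open.
- by move=> i; apply: sfg; [exact: tdom_open|exact: smooth_frame].
- by move=> x tx /=; rewrite eE; exact: basis_free (hb x tx).
- move=> x tx /=; rewrite eE (span_basis (hb x tx)); apply/seteqP; split => q /=.
    by move=> [u _ <-]; rewrite -hE memv_img // memvf.
  by move=> /memv_imgP[u _ ->]; exists u => //; rewrite hE.
Qed.

Lemma pair_plus_eq0 x (e1 e2 : A x * dualb A x) :
  pair_plus e1 e2 = 0 <-> pairing e1.2 e2.1 = - pairing e2.2 e1.1.
Proof.
rewrite /pair_plus; split=> [/eqP|->]; last by rewrite addNr mulr0.
by rewrite mulf_eq0 invr_eq0 pnatr_eq0 /= addr_eq0 => /eqP.
Qed.

(** An element of an isotropic [V] containing the graph is orthogonal to every [(v, h x v)], and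
    these equations determine its covector from its vector. *)
Lemma graph_maximally_isotropic (h : forall x, 'Hom(A x, dualb A x)) :
  (forall x u v, pairing (h x u) v = - pairing (h x v) u) ->
  maximally_isotropic (graph_map h).
Proof.
move=> sk x; split=> [_ _ [u _ <-] [v _ <-]|V iV LV].
  exact/pair_plus_eq0/sk.
apply/seteqP; split=> // -[u a] Vua; exists u => //; congr pair.
apply: pairing_inj => v; have Lv : graph_map h (v, h x v) by exists v.
by have /pair_plus_eq0 /= -> := iV _ _ Vua (LV _ Lv); rewrite sk.
Qed.

Lemma cograph_maximally_isotropic (h : forall x, 'Hom(dualb A x, A x)) :
  (forall x xi eta, pairing eta (h x xi) = - pairing xi (h x eta)) ->
  maximally_isotropic (cograph_map h).
Proof.
move=> sk x; split=> [_ _ [u _ <-] [v _ <-]|V iV LV].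
  exact/pair_plus_eq0/sk.
apply/seteqP; split=> // -[u a] Vua; exists a => //; congr pair.
apply/eqP; rewrite -subr_eq0; apply/eqP; apply: dual_separates => xi _.
have Lxi : cograph_map h (h x (xi x), xi x) by exists (xi x).
have /pair_plus_eq0 /= E := iV _ _ Vua (LV _ Lxi).
by rewrite pairingDr pairingNr sk E opprK subrr.
Qed.

End SharpAndSubbundles.

(** * Explicit formulas for the differential and the Courant bracket *)

Section Wedge.
Context (R : realType).

(** A leading entry sent to the second factor precedes every entry of the first one, and each such
    pair is an inversion. *)
Lemma inversions_cons k (b : bool) (m : k.-tuple bool) :
  inversions [tuple of b :: m] = (~~ b * count id m + inversions m)%N.
Proof.
have tS i : tnth [tuple of b :: m] (lift ord0 i) = tnth m i by rewrite tnthS.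
rewrite /inversions big_ord_recl; congr addn.
  rewrite big_mkcond big_ord_recl /= add0n.
  under eq_bigr do rewrite tS tnth0 /=.
  case: b {tS} => /=; first by rewrite big1.
  rewrite mul1n -sum1_count big_tuple [RHS]big_mkcond; apply: eq_bigr => i _.
  by case: (tnth m i).
apply: eq_bigr => i _; rewrite big_mkcond big_ord_recl /= add0n.
by rewrite [RHS]big_mkcond; apply: eq_bigr => j _; rewrite !tS.
Qed.

Lemma wedge_nil (T : Type) (f g : seq T -> R) :
  wedge f g [::] = f [::] * g [::].
Proof.
rewrite /wedge (big_pred1 [tuple]) /=; last by move=> m; apply/esym/eqP; exact: tuple0.
by rewrite /inversions big_ord0 expr0 mul1r.
Qed.

(** Shuffles are split by the factor receiving [x]; giving [x] to [g] costs one sign per argument of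
    [f], absorbed in the modified first factor. The low-degree formulas follow by recursion. *)
Lemma wedge_cons (T : Type) (f g : seq T -> R) x s :
  wedge f g (x :: s) =
  wedge (Defs.contract x f) g s +
  wedge (fun s => (-1) ^+ size s * f s) (Defs.contract x g) s.
Proof.
rewrite /wedge (reindex (fun bm : bool * (size s).-tuple bool =>
  [tuple of bm.1 :: bm.2])) /=; last first.
  exists (fun m => (thead m, [tuple of behead m])) => [[b m] _|m _].
    by congr pair; apply: val_inj.
  by rewrite [RHS]tuple_eta.
pose F (b : bool) (m : (size s).-tuple bool) : R :=
  (-1) ^+ inversions [tuple of b :: m] * f (mask (b :: m) (x :: s)) *
  g (mask (~~ b :: map negb m) (x :: s)).
rewrite -(pair_bigA _ F) /F /=.
rewrite big_bool; congr (_ + _); apply: eq_bigr => m _.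
  by rewrite inversions_cons.
rewrite inversions_cons mul1n exprD size_mask ?size_tuple // /Defs.contract.
by rewrite -!mulrA mulrCA.
Qed.

Lemma wedge1 (T : Type) (f g : seq T -> R) x :
  wedge f g [:: x] = f [:: x] * g [::] + f [::] * g [:: x].
Proof. by rewrite wedge_cons !wedge_nil /Defs.contract /= mul1r. Qed.

Lemma wedge2 (T : Type) (f g : seq T -> R) x y :
  wedge f g [:: x; y] = f [:: x; y] * g [::] + f [:: x] * g [:: y]
    - f [:: y] * g [:: x] + f [::] * g [:: x; y].
Proof. by rewrite wedge_cons !wedge1 /Defs.contract /=; ring. Qed.

Lemma wedge3 (T : Type) (f g : seq T -> R) x y z :
  wedge f g [:: x; y; z] = f [:: x; y; z] * g [::]
    + (f [:: x; y] * g [:: z] - f [:: x; z] * g [:: y] + f [:: y; z] * g [:: x])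
    + (f [:: x] * g [:: y; z] - f [:: y] * g [:: x; z] + f [:: z] * g [:: x; y])
    + f [::] * g [:: x; y; z].
Proof. by rewrite wedge_cons !wedge2 /Defs.contract /=; ring. Qed.

Lemma wedge_homogeneous (T : Type) (f g : seq T -> R) k l s :
  (forall s, size s != k -> f s = 0) -> (forall s, size s != l -> g s = 0) ->
  size s != (k + l)%N -> wedge f g s = 0.
Proof.
move=> fk gl sn; rewrite /wedge big1 // => m _.
have [sk|/fk ->] := eqVneq (size (mask m s)) k; last by rewrite mulr0 mul0r.
rewrite gl ?mulr0 //; apply: contra sn => /eqP <-; rewrite -sk.
rewrite !size_mask ?size_map ?size_tuple // count_map -[X in X == _](size_tuple m).
by rewrite -(count_predC id).
Qed.

End Wedge.

(** * Differentials in low degree and the Courant cochain *)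

Section Calculus.
Context (R : realType) (n : nat) (M : manifold R n).
Context (r : nat) (A : vbundle M r) (LA : lie_algebroid A).
Context (phi0 : rsec (dualb A)).
Implicit Types (X Y Z W : rsec A) (f g : M -> R) (w : rform A).

Lemma anchorD x (u : A x) f g : Cinf M f -> Cinf M g ->
  anchor LA u (fun y => f y + g y) = anchor LA u f + anchor LA u g.
Proof.
move=> sf sg; have [lin _] := anchor_tangent LA u.
have := lin 1 f g sf sg; rewrite mul1r => <-; congr (anchor LA u _).
by apply: funext => y; rewrite mul1r.
Qed.

Lemma anchorM x (u : A x) f g : Cinf M f -> Cinf M g ->
  anchor LA u (fun y => f y * g y) = anchor LA u f * g x + f x * anchor LA u g.
Proof. by move=> sf sg; have [_] := anchor_tangent LA u; apply. Qed.

Lemma anchor0 x (u : A x) : anchor LA u (fun=> 0) = 0.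
Proof.
have /eqP := @anchorD x u _ _ (@Cinf_cst R n M 0) (@Cinf_cst R n M 0).
under [X in anchor LA u X]funext do rewrite addr0.
by rewrite -subr_eq subrr eq_sym => /eqP.
Qed.

Lemma anchorZ x (u : A x) a f : Cinf M f ->
  anchor LA u (fun y => a * f y) = a * anchor LA u f.
Proof.
move=> sf; have [lin _] := anchor_tangent LA u.
have := lin a f _ sf (@Cinf_cst R n M 0); rewrite anchor0 addr0 => <-.
by congr (anchor LA u _); apply: funext => y; rewrite addr0.
Qed.

Lemma anchorN x (u : A x) f : Cinf M f ->
  anchor LA u (fun y => - f y) = - anchor LA u f.
Proof.
move=> sf; rewrite -mulN1r -anchorZ //; congr (anchor LA u _).
by apply: funext => y; rewrite mulN1r.
Qed.

Lemma anchorDv x (u v : A x) f : Cinf M f ->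
  anchor LA (u + v) f = anchor LA u f + anchor LA v f.
Proof. by move=> sf; rewrite -[u in LHS]scale1r anchor_linear // mul1r. Qed.

Lemma anchor0v x f : Cinf M f -> anchor LA (0 : A x) f = 0.
Proof.
move=> sf; have /eqP := @anchorDv x 0 0 f sf.
by rewrite addr0 -subr_eq subrr eq_sym => /eqP.
Qed.

Lemma anchorZv x a (u : A x) f : Cinf M f ->
  anchor LA (a *: u) f = a * anchor LA u f.
Proof.
by move=> sf; rewrite -[a *: u]addr0 anchor_linear // anchor0v // addr0.
Qed.

Lemma lieDl X Y Z x : Gamma A X -> Gamma A Y -> Gamma A Z ->
  lie LA (fun y => X y + Y y) Z x = lie LA X Z x + lie LA Y Z x.
Proof.
move=> sX sY sZ; have := lie_linear LA 1 sX sY sZ x; rewrite scale1r => <-.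
by congr (lie LA _ Z x); apply: rsecP => y; rewrite scale1r.
Qed.

Lemma lieDr X Y Z x : Gamma A X -> Gamma A Y -> Gamma A Z ->
  lie LA Z (fun y => X y + Y y) x = lie LA Z X x + lie LA Z Y x.
Proof.
move=> sX sY sZ; rewrite lie_skew ?lieDl //; last exact: GammaD.
by rewrite (lie_skew LA sZ sX) (lie_skew LA sZ sY) opprD.
Qed.

Lemma lieZr X Y f x : Gamma A X -> Gamma A Y -> Cinf M f ->
  lie LA X (fun y => f y *: Y y) x = f x *: lie LA X Y x + anchor LA (X x) f *: Y x.
Proof. by move=> sX sY sf; exact: lie_leibniz. Qed.

Lemma lieZl X Y f x : Gamma A X -> Gamma A Y -> Cinf M f ->
  lie LA (fun y => f y *: X y) Y x = f x *: lie LA X Y x - anchor LA (Y x) f *: X x.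
Proof.
move=> sX sY sf; rewrite lie_skew ?lieZr //; last exact: GammaZ.
by rewrite opprD (lie_skew LA sX sY) scalerN.
Qed.

Lemma dA1 (c : cochain A) X x : dA LA c [:: X] x = anchor LA (X x) (c [::]).
Proof.
rewrite /dA /= !big_ord_recl !big_ord0 /= !(big_mkcond (fun j => _ < _)%N).
by rewrite !big_ord_recl !big_ord0 /= /remove /bump /=; ring.
Qed.

Lemma dA2 (c : cochain A) X Y x : dA LA c [:: X; Y] x =
  anchor LA (X x) (c [:: Y]) - anchor LA (Y x) (c [:: X])
  - c [:: lie LA X Y] x.
Proof.
rewrite /dA /= !big_ord_recl !big_ord0 /= !(big_mkcond (fun j => _ < _)%N).
by rewrite !big_ord_recl !big_ord0 /= /remove /bump /=; ring.
Qed.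

Lemma dA3 (c : cochain A) X Y Z x : dA LA c [:: X; Y; Z] x =
  anchor LA (X x) (c [:: Y; Z]) - anchor LA (Y x) (c [:: X; Z])
  + anchor LA (Z x) (c [:: X; Y]) - c [:: lie LA X Y; Z] x
  + c [:: lie LA X Z; Y] x - c [:: lie LA Y Z; X] x.
Proof.
rewrite /dA /= !big_ord_recl !big_ord0 /= !(big_mkcond (fun j => _ < _)%N).
by rewrite !big_ord_recl !big_ord0 /= /remove /bump /=; ring.
Qed.

Definition dphi3 w X Y Z (x : M) : R :=
  anchor LA (X x) (fun y => w y [:: Y y; Z y])
  - anchor LA (Y x) (fun y => w y [:: X y; Z y])
  + anchor LA (Z x) (fun y => w y [:: X y; Y y])
  - w x [:: lie LA X Y x; Z x] + w x [:: lie LA X Z x; Y x]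
  - w x [:: lie LA Y Z x; X x]
  + pairing (phi0 x) (X x) * w x [:: Y x; Z x]
  - pairing (phi0 x) (Y x) * w x [:: X x; Z x]
  + pairing (phi0 x) (Z x) * w x [:: X x; Y x].

Lemma dphi_form3 w X Y Z x : kform 2 w ->
  dphi LA phi0 (form_cochain w) [:: X; Y; Z] x = dphi3 w X Y Z x.
Proof.
move=> kw; rewrite /dphi dA3 wedge3 /dphi3 /form_cochain /sec_cochain /=.
ring.
Qed.

(** [presymplectic] quantifies over lists of all lengths. Each term of [dA] evaluates [w] on a list
    one shorter, and the wedge term has degree 1 + 2, so all terms vanish off length 3. *)
Lemma dphi_form_degree w s x : kform 2 w -> size s != 3 ->
  dphi LA phi0 (form_cochain w) s x = 0.
Proof.
move=> kw s3; rewrite /dphi.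
rewrite (@wedge_homogeneous _ _ _ _ 1 2) ?addr0 //; last 2 first.
- by move=> [|X [|Y t]].
- by move=> t t2; rewrite /form_cochain (kform_degree kw) // size_map.
have sr (T : Type) i (t : seq T) : (i < size t)%N -> size (remove i t) = (size t).-1.
  move=> it; rewrite size_cat size_takel ?(ltnW it) // size_drop.
  by case: (size t) it => // m im; rewrite subSS /= subnKC.
have w0 (t : seq (rsec A)) : size t != 2 -> form_cochain w t = fun=> 0.
  by move=> t2; apply: funext => y; rewrite /form_cochain (kform_degree kw) // size_map.
rewrite /dA big1 => [|i _]; last first.
  rewrite w0 ?anchor0 ?mulr0 // sr //.
  by apply: contra s3; case: (size s) i => [[]|m i /eqP /= ->].
rewrite add0r big1 // => i _; rewrite big1 // => j ij.
rewrite w0 ?mulr0 //= sr sr //; last first.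
  by rewrite -ltnS prednK ?(leq_trans _ (ltn_ord j)) //; exact: leq_trans ij (ltnW (ltn_ord j)).
apply: contra s3; case: (size s) i j ij => [[]//|[|m]] i j ij /eqP /=.
  by case: i j ij => [[|]] //= ? [[|]].
by move=> [->].
Qed.

Lemma presymplecticP w : kform 2 w ->
  (presymplectic LA phi0 w <->
   forall X Y Z, Gamma A X -> Gamma A Y -> Gamma A Z ->
     forall x, dphi3 w X Y Z x = 0).
Proof.
move=> kw; split=> [[_ dw] X Y Z sX sY sZ x|dw].
  by rewrite -dphi_form3 // dw //=; apply/and4P; split=> //; exact: mem_set.
split=> // s Gs x; have [/eqP s3|] := eqVneq (size s) 3; last exact: dphi_form_degree.
case: s Gs s3 => [|X [|Y [|Z [|W s]]]] // /and4P[/set_mem sX /set_mem sY /set_mem sZ _] _.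
by rewrite dphi_form3 // dw.
Qed.

(** In each Lie derivative the terms differentiating along [W], and those containing [phi0] on [W],
    cancel by Cartan's formula; such terms survive in the [pair_minus] part alone. *)
Lemma courant_cochainE X xi Y eta W x : Gamma A X -> Gamma A Y -> Gamma A W ->
  Gamma (dualb A) xi -> Gamma (dualb A) eta ->
  courant_cochain LA phi0 X xi Y eta [:: W] x =
  anchor LA (X x) (fun y => pairing (eta y) (W y))
  - pairing (eta x) (lie LA X W x) + pairing (phi0 x) (X x) * pairing (eta x) (W x)
  - anchor LA (Y x) (fun y => pairing (xi y) (W y))
  + pairing (xi x) (lie LA Y W x) - pairing (phi0 x) (Y x) * pairing (xi x) (W x)
  + anchor LA (W x) (fun y => pair_minus (X y, xi y) (Y y, eta y))
  + pairing (phi0 x) (W x) * pair_minus (X x, xi x) (Y x, eta x).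
Proof.
move=> sX sY sW sxi seta.
rewrite /courant_cochain /Lphi /Defs.contract /dphi !dA1 !dA2 !wedge1 !wedge2.
rewrite /sec_cochain /fun_cochain /=.
ring.
Qed.

End Calculus.

Arguments Defs.formN {R n M r A} w N x s.

(** * Graphs of two-forms *)

Section GraphsOfForms.
Context (R : realType) (n : nat) (M : manifold R n).
Context (r : nat) (A : vbundle M r) (LA : lie_algebroid A).
Context (phi0 : rsec (dualb A)).
Implicit Types (X Y Z W : rsec A) (w : rform A).

Lemma flat_Gamma w X : kform 2 w -> Gamma A X ->
  Gamma (dualb A) (fun x => flat w x (X x)).
Proof. by move=> kw; apply: flat_smooth kw openT. Qed.

(** On the graph, [pair_minus] is w(X, Y) because [w] is skew; the terms then match the twisted
    differential one by one, except the one with the bracket of [X] and [Y]. *)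
Lemma courant_flat w X Y W x : kform 2 w ->
  Gamma A X -> Gamma A Y -> Gamma A W ->
  courant_cochain LA phi0 X (fun y => flat w y (X y)) Y
    (fun y => flat w y (Y y)) [:: W] x =
  dphi3 LA phi0 w X Y W x + w x [:: lie LA X Y x; W x].
Proof.
move=> kw sX sY sW; rewrite courant_cochainE //; try exact: flat_Gamma.
have pmE y : pair_minus (X y, flat w y (X y)) (Y y, flat w y (Y y)) =
    w y [:: X y; Y y].
  by rewrite /pair_minus !(flatE _ _ kw) (kform2_skew (Y y)) //=; field.
under [F in anchor LA (W x) F]funext do rewrite pmE.
under [F in anchor LA (X x) F]funext do rewrite (flatE _ _ kw).
under [F in anchor LA (Y x) F]funext do rewrite (flatE _ _ kw).
rewrite pmE !(flatE _ _ kw) /dphi3 (kform2_skew (lie LA X W x)) //.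
by rewrite (kform2_skew (lie LA Y W x)) //; ring.
Qed.

Lemma graph_mapE (h : forall x, 'Hom(A x, dualb A x)) x u xi :
  graph_map h (u, xi) <-> xi = h x u.
Proof. by split=> [[v _ [<- <-]]|->] //; exists u. Qed.

Lemma cograph_mapE (h : forall x, 'Hom(dualb A x, A x)) x u xi :
  cograph_map h (u, xi) <-> u = h x xi.
Proof. by split=> [[v _ [<- <-]]|->] //; exists xi. Qed.

Lemma presymplectic_graph_dirac w :
  presymplectic LA phi0 w -> dirac_structure LA phi0 (graph_map (flat w)).
Proof.
move=> pw; have [kw _] := pw; have /(presymplecticP _ _ kw) dw := pw; split.
- apply: (@subbundle_range _ _ _ _ _ A (fun x u => u) (fun x u => flat w x u)) => //.
  + by move=> x a u v; exact: linearP.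
  + by move=> U Z oU sZ; split=> //; exact: flat_smooth.
- by apply: graph_maximally_isotropic => x u v; rewrite !flatE // kform2_skew.
- move=> X xi Y eta sX sxi sY seta LX LY.
  have -> : xi = fun x => flat w x (X x).
    by apply: rsecP => x; exact/graph_mapE/LX.
  have -> : eta = fun x => flat w x (Y x).
    by apply: rsecP => x; exact/graph_mapE/LY.
  exists (fun x => flat w x (lie LA X Y x)); split.
  + by apply: flat_Gamma => //; exact: lie_smooth.
  + by move=> W sW x; rewrite courant_flat // dw // add0r flatE.
  + by move=> x; exact/graph_mapE.
Qed.

Lemma dirac_graph_presymplectic w : kform 2 w ->
  dirac_structure LA phi0 (graph_map (flat w)) -> presymplectic LA phi0 w.
Proof.
move=> kw [_ _ cl]; apply/presymplecticP => // X Y Z sX sY sZ x.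
have LX V y : graph_map (flat w) (V y, flat w y (V y)) by exact/graph_mapE.
have [zeta [_ zE zL]] := cl _ _ _ _ sX (flat_Gamma kw sX) sY (flat_Gamma kw sY)
  (LX X) (LX Y).
have := zE Z sZ x; rewrite courant_flat //.
(* Membership in the graph makes [zeta] equal to [w] of the bracket, so the other summand, the
   differential, is zero. *)
have /graph_mapE -> := zL x; rewrite flatE // => /eqP.
by rewrite -subr_eq subrr eq_sym => /eqP.
Qed.

(* When the [Y i] are images of the [X i] under a recursion operator, the right
   hand side pairs [Z] with its Nijenhuis torsion. *)
Lemma dphi3_relation w0 w1 w2 X1 Y1 X2 Y2 Z x :
  kform 2 w0 -> kform 2 w1 -> kform 2 w2 ->
  (forall y v, w0 y [:: Y1 y; v] = w1 y [:: X1 y; v]) ->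
  (forall y v, w0 y [:: Y2 y; v] = w1 y [:: X2 y; v]) ->
  (forall y v, w1 y [:: Y1 y; v] = w2 y [:: X1 y; v]) ->
  (forall y v, w1 y [:: Y2 y; v] = w2 y [:: X2 y; v]) ->
  dphi3 LA phi0 w0 Y1 Y2 Z x - dphi3 LA phi0 w1 Y1 X2 Z x
  - dphi3 LA phi0 w1 X1 Y2 Z x + dphi3 LA phi0 w2 X1 X2 Z x =
  - (w0 x [:: lie LA Y1 Y2 x; Z x] - w1 x [:: lie LA Y1 X2 x; Z x]
     - w1 x [:: lie LA X1 Y2 x; Z x] + w2 x [:: lie LA X1 X2 x; Z x]).
Proof.
move=> k0 k1 k2 h01 h02 h11 h12; rewrite /dphi3.
have fE (f g : M -> R) : f =1 g -> f = g by exact: funext.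
rewrite (fE (fun y => w0 y [:: Y2 y; Z y]) _ (fun y => h02 y _)).
rewrite (fE (fun y => w0 y [:: Y1 y; Z y]) _ (fun y => h01 y _)).
rewrite (fE (fun y => w0 y [:: Y1 y; Y2 y]) _ (fun y => h01 y _)).
rewrite (fE (fun y => w1 y [:: Y1 y; Z y]) _ (fun y => h11 y _)).
rewrite (fE (fun y => w1 y [:: Y1 y; X2 y]) _ (fun y => h11 y _)).
rewrite (fE (fun y => w1 y [:: Y2 y; Z y]) _ (fun y => h12 y _)).
(* Skewness carries the hypotheses over to the second argument; everything but the four brackets
   paired with [Z] then cancels. *)
have s01 v : w0 x [:: v; Y1 x] = w1 x [:: v; X1 x].
  by rewrite kform2_skew // h01 -kform2_skew.
have s02 v : w0 x [:: v; Y2 x] = w1 x [:: v; X2 x].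
  by rewrite kform2_skew // h02 -kform2_skew.
have s11 v : w1 x [:: v; Y1 x] = w2 x [:: v; X1 x].
  by rewrite kform2_skew // h11 -kform2_skew.
have s12 v : w1 x [:: v; Y2 x] = w2 x [:: v; X2 x].
  by rewrite kform2_skew // h12 -kform2_skew.
by rewrite !s01 !s02 !s11 !s12 !h01 !h11 !h02 !h12; ring.
Qed.

(** In the use made of it, [X' = N X], [Y' = N Y] and [w1 = w_N]. The derivative terms of the
    Courant cochain and of d w1 regroup into the two differentials of [w] on the right. *)
Lemma courant_recursion w w1 X X' Y Y' Z x : kform 2 w -> kform 2 w1 ->
  Gamma A X -> Gamma A X' -> Gamma A Y -> Gamma A Y' -> Gamma A Z ->
  (forall y v, w1 y [:: X y; v] = w y [:: X' y; v]) ->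
  (forall y v, w1 y [:: Y y; v] = w y [:: Y' y; v]) ->
  courant_cochain LA phi0 X' (fun y => flat w y (X y)) Y'
    (fun y => flat w y (Y y)) [:: Z] x + dphi3 LA phi0 w1 X Y Z x =
  w x [:: lie LA X' Y x; Z x] + w x [:: lie LA X Y' x; Z x]
  - w1 x [:: lie LA X Y x; Z x]
  + dphi3 LA phi0 w X' Y Z x + dphi3 LA phi0 w X Y' Z x.
Proof.
move=> kw kw1 sX sX' sY sY' sZ hX hY.
rewrite courant_cochainE //; try exact: flat_Gamma.
(* Both sides equal w1(X, Y); this collapses the antisymmetrised pairing below to a single value of
   [w]. *)
have XY y : w y [:: X' y; Y y] = w y [:: X y; Y' y].
  by rewrite -hX kform2_skew // hY -kform2_skew.
have pmE y : pair_minus (X' y, flat w y (X y)) (Y' y, flat w y (Y y)) =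
    w y [:: X y; Y' y].
  by rewrite /pair_minus !(flatE _ _ kw) /= (kform2_skew (Y y)) // XY; field.
under [F in anchor LA (Z x) F]funext do rewrite pmE.
under [F in anchor LA (X' x) F]funext do rewrite (flatE _ _ kw).
under [F in anchor LA (Y' x) F]funext do rewrite (flatE _ _ kw).
rewrite pmE !(flatE _ _ kw) /dphi3.
have fE (f g : M -> R) : f =1 g -> f = g by exact: funext.
rewrite (fE (fun y => w1 y [:: Y y; Z y]) _ (fun y => hY y _)).
rewrite (fE (fun y => w1 y [:: X y; Z y]) _ (fun y => hX y _)).
rewrite (fE (fun y => w1 y [:: X y; Y y]) _ (fun y => hX y _)).
rewrite (kform2_skew (Y x) (lie LA X' Z x)) // (kform2_skew (X x) (lie LA Y' Z x)) //.
have sX1 v : w1 x [:: v; X x] = w x [:: v; X' x].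
  by rewrite kform2_skew // hX -kform2_skew.
have sY1 v : w1 x [:: v; Y x] = w x [:: v; Y' x].
  by rewrite kform2_skew // hY -kform2_skew.
by rewrite !sX1 !sY1 !hX !hY !XY; ring.
Qed.

End GraphsOfForms.

(** * Recursion operators and Omega-N structures *)

Section RecursionOperators.
Context (R : realType) (n : nat) (M : manifold R n).
Context (r : nat) (A : vbundle M r) (LA : lie_algebroid A).
Context (phi0 : rsec (dualb A)).
Implicit Types (X Y Z W : rsec A) (w : rform A) (N : forall x, 'End(A x)).

(** Smoothness is asked on every open set because [N] is applied to local frames as well as to
    global sections. *)
Definition smooth_endo N : Prop := forall U X, open U ->
  smooth_sec_on U X -> smooth_sec_on U (fun x => N x (X x)).

Lemma smooth_endo_Gamma N X : smooth_endo N -> Gamma A X ->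
  Gamma A (fun x => N x (X x)).
Proof. by move=> sN; exact: sN openT. Qed.

Lemma formNE w N x u v : kform 2 w -> Defs.formN w N x [:: u; v] = w x [:: N x u; v].
Proof. by move=> kw; rewrite /Defs.formN /flatN comp_lfunE flatE. Qed.

Lemma flat_formN w N : kform 2 w -> kform 2 (Defs.formN w N) ->
  flat (Defs.formN w N) = flatN w N.
Proof.
move=> kw kN; apply: functional_extensionality_dep => x; apply/lfunP => u.
by apply: pairing_inj => v; rewrite flatE // formNE // /flatN comp_lfunE flatE.
Qed.

Lemma kform_formN w N : kform 2 w -> smooth_endo N ->
  (forall x u, w x [:: N x u; u] = 0) -> kform 2 (Defs.formN w N).
Proof.
move=> kw sN alt; apply: bilinear_kform2 => [x u|t tt i].
  by rewrite /flatN comp_lfunE flatE.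
have -> : (fun x => flatN w N x (frame t i x)) =
    (fun x => flat w x (N x (frame t i x))).
  by apply: functional_extensionality_dep => x; rewrite /flatN comp_lfunE.
apply: flat_smooth => //; first exact: tdom_open.
apply: sN; first exact: tdom_open.
exact: smooth_frame.
Qed.

Lemma flat_compatibleP w N : kform 2 w ->
  (flat_compatible w N <->
   forall x u v, w x [:: N x u; v] = w x [:: u; N x v]).
Proof.
move=> kw; split=> [H x u v|H x].
  rewrite -flatE // -comp_lfunE H comp_lfunE.
  by rewrite dual_mapE flatE.
apply/lfunP => u; apply: pairing_inj => v.
by rewrite !comp_lfunE dual_mapE !flatE // H.
Qed.

Lemma dual_map_Gamma N (xi : rsec (dualb A)) : smooth_endo N ->
  Gamma (dualb A) xi -> Gamma (dualb A) (fun x => dual_map N x (xi x)).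
Proof.
move=> sN sxi _ [t tt <-] j; rewrite setIT.
have ot := tdom_open t.
have sW : smooth_fun (tdom t) (fun x => pairing (xi x) (N x (frame t j x))).
  apply: pairing_smooth ot (smooth_sec_sub _ sxi) (sN _ _ ot _) => //.
  exact: smooth_frame.
apply: (smooth_fun_eq ot _ sW) => x _.
by rewrite /= dtmapE -dual_mapE.
Qed.

(** The dual of the graph of [N] consists of the pairs [(a, N^* a)], so the torsion of the relation
    is the pairing of [a] with the torsion of [N], and dual sections separate vectors. *)
Lemma Nijenhuis_graph (S : forall x, set (A x * A x)) N :
  smooth_endo N -> (forall x u v, S x (u, v) <-> v = N x u) ->
  (Nijenhuis_relation LA S <-> Nijenhuis LA N).
Proof.
move=> sN SE; split=> [NS X Y sX sY x|NN].
  apply: dual_separates => xi sxi.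
  have sNX V : Gamma A V -> Gamma A (fun x => N x (V x)) by exact: smooth_endo_Gamma.
  have s1 := dual_map_Gamma sN sxi; have s2 := dual_map_Gamma sN s1.
  have := NS _ _ _ _ _ _ _ sX (sNX _ sX) sY (sNX _ sY) sxi s1 s2 _ _ _ _ x.
  rewrite /rel_torsion !dual_mapE => <-; first last.
  - by move=> y u v /SE ->; rewrite /= dual_mapE.
  - by move=> y u v /SE ->; rewrite /= dual_mapE.
  - by move=> y; exact/SE.
  - by move=> y; exact/SE.
  by rewrite /torsion linearD !pairingDr !pairingNr; ring.
move=> X1 Y1 X2 Y2 a b c sX1 _ sX2 _ sa sb sc S1 S2 ab bc x.
have -> : Y1 = fun x => N x (X1 x) by apply: rsecP => y; exact/SE/S1.
have -> : Y2 = fun x => N x (X2 x) by apply: rsecP => y; exact/SE/S2.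
have bE u : pairing (b x) u = pairing (a x) (N x u) by apply: ab; exact/SE.
have cE u : pairing (c x) u = pairing (b x) (N x u) by apply: bc; exact/SE.
have := NN _ _ sX1 sX2 x; rewrite /torsion => T0.
have := congr1 (pairing (a x)) T0; rewrite !pairingDr !pairingNr pairing0r => <-.
by rewrite /rel_torsion cE !bE linearD pairingDr; ring.
Qed.

Lemma OmegaN_dirac_pair w N (L := graph_map (flat w))
    (L' := graph_map (flatN w N)) :
  smooth_endo N -> OmegaN_structure LA phi0 w N ->
  (forall x, Nplus w N x = rel_dual (Nrel L L') x) ->
  dirac_pair LA phi0 L L'.
Proof.
move=> sN [_ comp NN pw pN] NplusE.
have [kw _] := pw; have [kN _] := pN.
have /(presymplecticP _ _ kw) dw := pw; have /(presymplecticP _ _ kN) dN := pN.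
have /(flat_compatibleP _ kw) cN := comp.
have LNE := flat_formN kw kN; rewrite /L'.
split; first exact: presymplectic_graph_dirac.
  by rewrite -LNE; exact: presymplectic_graph_dirac.
have sNX V : Gamma A V -> Gamma A (fun x => N x (V x)) by exact: smooth_endo_Gamma.
pose N2 x : 'End(A x) := (N x \o N x)%VF.
have sN2 : smooth_endo N2.
  move=> U X oU sX; have -> : (fun x => N2 x (X x)) = (fun x => N x (N x (X x))).
    by apply: rsecP => x; rewrite /N2 comp_lfunE.
  by apply: (sN) => //; exact: sN.
have k2 : kform 2 (Defs.formN w N2).
  by apply: kform_formN => // x u; rewrite comp_lfunE cN kform2_alt.
have w2E x u v : Defs.formN w N2 x [:: u; v] = Defs.formN w N x [:: N x u; v].
  by rewrite !formNE // comp_lfunE.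
(* The torsion of [N] vanishes, so the relation identity with [Y_i = N X_i] yields closedness of the
   third form from that of the other two. *)
have d2 X Y Z x : Gamma A X -> Gamma A Y -> Gamma A Z ->
    dphi3 LA phi0 (Defs.formN w N2) X Y Z x = 0.
  move=> sX sY sZ.
  have := @dphi3_relation _ _ _ _ _ LA phi0 w (Defs.formN w N) (Defs.formN w N2)
    X (fun x => N x (X x)) Y (fun x => N x (Y x)) Z x kw kN k2.
  rewrite dw ?dN ?subr0 ?add0r; try by [|exact: sNX].
  move=> -> //; try by move=> y v; rewrite ?w2E ?formNE.
  have T0 := congr1 (fun u => w x [:: u; Z x]) (NN X Y sX sY x).
  rewrite /torsion -!(flatE _ _ kw) !linearD !linearN linear0 in T0.
  rewrite !pairingDl !pairingNl pairing0l !(flatE _ _ kw) in T0.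
  by rewrite !formNE // comp_lfunE T0 oppr0.
move=> X1 Y1 X2 Y2 a b c sX1 sY1 sX2 sY2 sa sb sc S1 S2 ab bc x.
(* As [w] may be degenerate, the relation gives w Y = w N X and not Y = N X. *)
have SE X Y : (forall x, Nrel L L' x (X x, Y x)) ->
    forall y, flat w y (Y y) = flat w y (N y (X y)).
  move=> S y; have [al [/graph_mapE /= al1 /graph_mapE /= al2]] := S y.
  by rewrite -al2 al1 /flatN comp_lfunE.
have {}S1 := SE _ _ S1; have {}S2 := SE _ _ S2.
(* The hypothesis on [Nplus] represents the covectors at the point: a = w u, b = w N u = w u' and c
   = w N u'. *)
have [u _ [aE bE]] : Nplus w N x (a x, b x) by rewrite NplusE.
have [u' _ [bE' cE]] : Nplus w N x (b x, c x) by rewrite NplusE.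
(* Although u' need not be N u, compatibility moves [N] across [w] and gives c = w N N u. *)
have cE2 v : pairing (c x) v = w x [:: N x (N x u); v].
  rewrite -cE /flatN comp_lfunE flatE // cN -flatE // bE' -bE.
  by rewrite /flatN comp_lfunE flatE // -cN.
(* The torsion involves the covectors through their values at [x], so any section extending [u] will
   do. *)
have [Z sZ Zx] := section_through u.
have := @dphi3_relation _ _ _ _ _ LA phi0 w (Defs.formN w N) (Defs.formN w N2)
    X1 Y1 X2 Y2 Z x kw kN k2.
rewrite dw ?dN ?d2 ?subr0 ?add0r //.
have h0 X Y y v : (forall y, flat w y (Y y) = flat w y (N y (X y))) ->
    w y [:: Y y; v] = Defs.formN w N y [:: X y; v].
  by move=> S; rewrite formNE // -flatE // S flatE.
have h1 X Y y v : (forall y, flat w y (Y y) = flat w y (N y (X y))) ->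
    Defs.formN w N y [:: Y y; v] = Defs.formN w N2 y [:: X y; v].
  by move=> S; rewrite w2E !formNE // [LHS]cN [RHS]cN -!flatE // S.
move=> /(_ (fun y v => h0 _ _ y v S1) (fun y v => h0 _ _ y v S2)
  (fun y v => h1 _ _ y v S1) (fun y v => h1 _ _ y v S2)) H.
rewrite [RHS]H.
rewrite /rel_torsion pairingDr cE2 -aE -bE /flatN comp_lfunE !flatE //.
rewrite !formNE // comp_lfunE Zx !(kform2_skew _ u) //.
by rewrite !cN; ring.
Qed.

Lemma dirac_pair_weak_OmegaN w N : kform 2 w -> smooth_endo N -> tensor11 N ->
  dirac_pair LA phi0 (graph_map (flat w)) (graph_map (flatN w N)) ->
  weak_OmegaN_structure LA phi0 w N.
Proof.
move=> kw sN tN [DL DL' NR].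
have iso := DL'; case: iso => _ iso _.
have gN x u : graph_map (flatN w N) (u, flatN w N x u) by exact/graph_mapE.
(* Isotropy of the graph of w N means that w N is skew, which is the compatibility of [w] with
   [N]. *)
have sk x u v : w x [:: N x u; v] = w x [:: u; N x v].
  have [iV _] := iso x; have /pair_plus_eq0 /= := iV _ _ (gN x u) (gN x v).
  by rewrite /flatN !comp_lfunE !flatE // => ->; rewrite [RHS]kform2_skew.
have kN : kform 2 (Defs.formN w N).
  (* By compatibility w(N u, u) equals its own opposite. *)
  apply: kform_formN => // x u; apply/eqP.
  by have /eqP := kform2_skew (N x u) u kw; rewrite -sk -addr_eq0 -mulr2n mulrn_eq0.
split=> //; first exact/flat_compatibleP.
- move=> X Y sX sY x; apply: separates => Z sZ.
  have sNX V : Gamma A V -> Gamma A (fun x => N x (V x)) by exact: smooth_endo_Gamma.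
  have SX V : forall x, Nrel (graph_map (flat w)) (graph_map (flatN w N)) x (V x, N x (V x)).
    move=> y; exists (flatN w N y (V y)); split; apply/graph_mapE => //=.
    by rewrite /flatN comp_lfunE.
  (* The pairs (w V, w N V) lie in the dual relation. The covectors of Z, N Z and N N Z therefore
     form admissible test data, on which the torsion of the relation is w(Z, T_N(X, Y)). *)
  have SZ V : forall x, rel_dual (Nrel (graph_map (flat w)) (graph_map (flatN w N))) x
      (flat w x (V x), flat w x (N x (V x))).
    move=> y u v [al [/graph_mapE /= al1 /graph_mapE /= al2]] /=.
    rewrite !flatE // sk [RHS]kform2_skew // [LHS]kform2_skew // -!flatE // -al2 al1.
    by rewrite /flatN comp_lfunE.
  have sZ1 := sNX _ sZ; have sZ2 := sNX _ sZ1.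
  have := NR _ _ _ _ _ _ _ sX (sNX _ sX) sY (sNX _ sY) (flat_Gamma kw sZ)
    (flat_Gamma kw sZ1) (flat_Gamma kw sZ2) (SX X) (SX Y) (SZ Z) (SZ _) x.
  rewrite /rel_torsion !flatE // => T0; rewrite kform2_skew // -[RHS]oppr0 -T0.
  congr (- _); rewrite !sk -!flatE // /torsion [N x (_ + _)]linearD.
  by rewrite !pairingDr !pairingNr; ring.
- exact: dirac_graph_presymplectic.
- by apply: dirac_graph_presymplectic => //; rewrite flat_formN.
Qed.

End RecursionOperators.

(** * The Schouten square of a bivector *)

Section Bivectors.
Context (R : realType) (n : nat) (M : manifold R n).
Context (r : nat) (A : vbundle M r) (LA : lie_algebroid A).
Implicit Types (X Y Z U V P Q : rsec A) (f g : M -> R).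
Implicit Types (xi eta theta : rsec (dualb A)).

Lemma wedge_funl (T : Type) (a : R) (h : seq T -> R) s :
  wedge (fun s => if s is [::] then a else 0) h s = a * h s.
Proof.
elim: s h => [|x s IH] h; first by rewrite wedge_nil.
rewrite wedge_cons.
have -> : Defs.contract x (fun s : seq T => if s is [::] then a else 0) = fun=> 0.
  by apply: funext.
have -> : (fun s : seq T => (-1) ^+ size s * (if s is [::] then a else 0)) =
    (fun s => if s is [::] then a else 0).
  by apply: funext => -[|y t] /=; rewrite ?mul1r ?mulr0.
rewrite IH [X in X + _]big1 ?add0r // => m _; by rewrite mulr0 mul0r.
Qed.

Lemma wedge_funr (T : Type) (a : R) (h : seq T -> R) s :
  wedge h (fun s => if s is [::] then a else 0) s = h s * a.
Proof.
elim: s h => [|x s IH] h; first by rewrite wedge_nil.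
rewrite wedge_cons IH.
have -> : Defs.contract x (fun s : seq T => if s is [::] then a else 0) = fun=> 0.
  by apply: funext.
by rewrite [X in _ + X]big1 ?addr0 // => m _; rewrite mulr0.
Qed.

Lemma kmvec_lin k (a : R) (P Q : rmvec A) : kmvec k P -> kmvec k Q ->
  kmvec k (fun y s => a * P y s + Q y s).
Proof.
move=> kP kQ; split.
- by move=> x s sk; rewrite (kform_degree kP) // (kform_degree kQ) // mulr0 addr0.
- by move=> x s1 s2 b u v; rewrite (kform_linear kP) (kform_linear kQ); ring.
- by move=> x s1 s2 s3 u; rewrite (kform_alternating kP) (kform_alternating kQ) mulr0 addr0.
- move=> t tt s; have ot := tdom_open t.
  apply: (smooth_funD ot); last exact: (kform_smooth kQ).
  by apply: (smooth_funM ot); [exact: smooth_fun_cst|exact: (kform_smooth kP)].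
Qed.

Lemma kmvec0 k : kmvec k ((fun _ _ => 0) : rmvec A).
Proof.
by split=> // *; [rewrite mulr0 addr0|exact: smooth_fun_cst].
Qed.

Lemma kmvecZ k f (P : rmvec A) : Cinf M f -> kmvec k P ->
  kmvec k (fun y s => f y * P y s).
Proof.
move=> sf kP; split.
- by move=> x s sk; rewrite (kform_degree kP) // mulr0.
- by move=> x s1 s2 b u v; rewrite (kform_linear kP); ring.
- by move=> x s1 s2 s3 u; rewrite (kform_alternating kP) mulr0.
- move=> t tt s; have ot := tdom_open t.
  apply: (smooth_funM ot); last exact: (kform_smooth kP).
  exact: smooth_fun_sub sf.
Qed.

Lemma kmvec_fun f : Cinf M f -> kmvec 0 (fun_mvec f : rmvec A).
Proof.
move=> sf; split.
- by move=> x [].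
- by move=> x [|? ?] s2 b u v /=; rewrite mulr0 addr0.
- by move=> x [|? ?] s2.
- move=> t tt [|? ?] /=; last exact: smooth_fun_cst.
  exact: smooth_fun_sub sf.
Qed.

Lemma kmvec_sec X : Gamma A X -> kmvec 1 (sec_mvec X).
Proof.
move=> sX; split.
- by move=> x [|? []].
- move=> x [|u1 [|u2 s1]] [|v1 s2] b u v /=; rewrite ?mulr0 ?addr0 //.
  by rewrite pairingDl pairingZl.
- by move=> x [|u1 [|u2 s1]] [|v1 s2] s3 u.
- move=> t tt [|i [|j s]] /=; try exact: smooth_fun_cst.
  have ot := tdom_open t; apply: pairing_smooth => //.
    exact: smooth_frame.
  exact: smooth_sec_sub sX.
Qed.

Definition wedge_sec U V : rmvec A := fun y => wedge (sec_mvec U y) (sec_mvec V y).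

Arguments wedge_sec U V x s : clear implicits.

Lemma wedge_secE U V x (xi eta : dualb A x) : wedge_sec U V x [:: xi; eta] =
  pairing xi (U x) * pairing eta (V x) - pairing eta (U x) * pairing xi (V x).
Proof. by rewrite /wedge_sec wedge2 /=; ring. Qed.

Lemma wedge_sec_degree U V x (s : seq (dualb A x)) :
  size s != 2 -> wedge_sec U V x s = 0.
Proof. by move=> s2; apply: (@wedge_homogeneous _ _ _ _ 1 1) => // -[|? []]. Qed.

Lemma kmvec_wedge_sec U V : Gamma A U -> Gamma A V -> kmvec 2 (wedge_sec U V).
Proof.
move=> sU sV; split.
- by move=> x s; exact: wedge_sec_degree.
- move=> x [|u1 [|u2 [|u3 s1]]] [|v1 [|v2 s2]] a u v;
    try (by rewrite !wedge_sec_degree ?mulr0 ?addr0 // ?size_cat /= ?addnS).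
  + by rewrite /= !wedge_secE !pairingDl !pairingZl; ring.
  + by rewrite /= !wedge_secE !pairingDl !pairingZl; ring.
- move=> x [|u1 s1] [|v1 s2] [|z s3] u;
    try (by rewrite !wedge_sec_degree // !size_cat /= ?size_cat /= ?addnS).
  by rewrite /= wedge_secE subrr.
- move=> t tt s; have ot := tdom_open t.
  have [s2|s2] := eqVneq (size s) 2; last first.
    apply: (smooth_fun_eq ot _ (smooth_fun_cst _ 0)) => y _.
    by rewrite wedge_sec_degree // size_map.
  case: s s2 => [|i [|j [|k s]]] // _.
  have sp W k : Gamma A W -> smooth_fun (tdom t) (fun y => pairing (frame t k y : dualb A y) (W y)).
    move=> sW; apply: pairing_smooth => //; first exact: smooth_frame.
    exact: smooth_sec_sub sW.
  apply: (smooth_fun_eq ot _ (smooth_funD ot (smooth_funM ot (sp _ i sU) (sp _ j sV))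
    (smooth_funN ot (smooth_funM ot (sp _ j sU) (sp _ i sV))))) => y _.
  by rewrite /= wedge_secE.
Qed.

(** This is the [sharp] of [wedge_sec U V], written as a combination of [U] and [V] so that the
    Leibniz rules apply. *)
Definition sharp_sec U V xi : rsec A := fun y =>
  pairing (xi y) (U y) *: V y + (- pairing (xi y) (V y)) *: U y.

(** Separate maps [F] and [G] polarise the expression, so that it can be expanded over a sum of
    decomposable bivectors. *)
Definition hamilton_term (F G : rsec (dualb A) -> rsec A) xi eta theta
    (x : M) : R :=
  pairing (theta x) (lie LA (F xi) (G eta) x)
  - anchor LA (F xi x) (fun y => pairing (theta y) (G eta y)).

(* For the bivector [p] with [sharp p = F = G] this is half of [p, p] evaluated
   at [xi, eta, theta]. *)
Definition hamilton_cyclic (F G : rsec (dualb A) -> rsec A) xi eta theta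
    (x : M) : R :=
  hamilton_term F G xi eta theta x + hamilton_term F G eta theta xi x
  + hamilton_term F G theta xi eta x.

Lemma pairing_Gamma xi X : Gamma (dualb A) xi -> Gamma A X ->
  Cinf M (fun y => pairing (xi y) (X y)).
Proof. exact: pairing_smooth openT. Qed.

Lemma sharp_sec_Gamma U V xi : Gamma A U -> Gamma A V -> Gamma (dualb A) xi ->
  Gamma A (sharp_sec U V xi).
Proof.
move=> sU sV sxi; apply: GammaL; first exact: pairing_Gamma.
  exact: sV.
by apply: GammaZ => //; apply: CinfN; exact: pairing_Gamma.
Qed.

Lemma lieZZ X Y f g x : Gamma A X -> Gamma A Y -> Cinf M f -> Cinf M g ->
  lie LA (fun y => f y *: X y) (fun y => g y *: Y y) x =
  (f x * g x) *: lie LA X Y x + (f x * anchor LA (X x) g) *: Y x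
  - (g x * anchor LA (Y x) f) *: X x.
Proof.
move=> sX sY sf sg; rewrite lieZr //; last exact: GammaZ.
rewrite lieZl // anchorZv // scalerBr !scalerA.
by rewrite [g x * f x]mulrC addrAC.
Qed.

(** Derivatives of the coefficients eta(P) and eta(Q) occur both in the bracket and in the anchor
    term and cancel; those of [xi] along [P], [Q] and of [theta] along [U], [V] remain. *)
Lemma hamilton_term_sharp_sec U V P Q xi eta theta x :
  Gamma A U -> Gamma A V -> Gamma A P -> Gamma A Q ->
  Gamma (dualb A) xi -> Gamma (dualb A) eta -> Gamma (dualb A) theta ->
  let a := pairing (xi x) (U x) in let b := - pairing (xi x) (V x) in
  let c := pairing (eta x) (P x) in let d := - pairing (eta x) (Q x) in
  let D (X Y : rsec A) (z : rsec (dualb A)) :=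
    anchor LA (X x) (fun y => pairing (z y) (Y y)) in
  let br X Y := pairing (theta x) (lie LA X Y x) in
  hamilton_term (sharp_sec U V) (sharp_sec P Q) xi eta theta x =
  a * c * br V Q + a * d * br V P + b * c * br U Q + b * d * br U P
  - (c * D Q U xi + d * D P U xi) * pairing (theta x) (V x)
  + (c * D Q V xi + d * D P V xi) * pairing (theta x) (U x)
  - a * (c * D V Q theta + d * D V P theta)
  - b * (c * D U Q theta + d * D U P theta).
Proof.
move=> sU sV sP sQ sxi seta stheta a b c d D br.
have sfa X (z : rsec (dualb A)) : Gamma (dualb A) z -> Gamma A X ->
    Cinf M (fun y => pairing (z y) (X y)) by exact: pairing_Gamma.
have sna X (z : rsec (dualb A)) : Gamma (dualb A) z -> Gamma A X ->
    Cinf M (fun y => - pairing (z y) (X y)).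
  by move=> sz sX; apply: CinfN; exact: sfa.
have sZ f X : Cinf M f -> Gamma A X -> Gamma A (fun y => f y *: X y) by exact: GammaZ.
rewrite /hamilton_term /sharp_sec.
rewrite lieDl; try by [apply: sZ; auto|apply: GammaD; apply: sZ; auto].
rewrite !lieDr; try by apply: sZ; auto.
rewrite !lieZZ; try by auto.
have -> : (fun y => pairing (theta y)
      (pairing (eta y) (P y) *: Q y + (- pairing (eta y) (Q y)) *: P y)) =
    (fun y => pairing (eta y) (P y) * pairing (theta y) (Q y)
      + (- pairing (eta y) (Q y)) * pairing (theta y) (P y)).
  by apply: funext => y; rewrite pairingDr !pairingZr.
rewrite anchorD ?anchorM; try by [auto|apply: CinfM; auto].
rewrite !anchorN; try by auto.
rewrite !anchorDv ?anchorZv; try by auto.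
rewrite !pairingDr !pairingNr !pairingZr.
rewrite -/a -/b -/c -/d /D /br; ring.
Qed.

End Bivectors.

Arguments wedge_sec {R n M r A} U V x s.

(** * Schouten bracket of decomposable bivectors *)

Section SchoutenBracket.
Context (R : realType) (n : nat) (M : manifold R n).
Context (r : nat) (A : vbundle M r) (LA : lie_algebroid A).
Context (B : rmvec A -> rmvec A -> rmvec A) (hB : is_schouten LA B).
Arguments B : clear implicits.
Implicit Types (X Y Z U V : rsec A) (f g : M -> R) (P Q D : rmvec A).
Implicit Types (xi eta theta : rsec (dualb A)).

Lemma rmvecP P Q : (forall x s, P x s = Q x s) -> P = Q.
Proof.
by move=> H; apply: functional_extensionality_dep => x; apply: funext => s.
Qed.

Lemma schouten0l l Q x s : kmvec l Q -> B (fun _ _ => 0) Q x s = 0.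
Proof.
move=> kQ; have k0 := @kmvec0 _ _ _ _ A 0.
(* The coefficient -1 gives B 0 = - B 0 + B 0 = 0. *)
have := schouten_linear hB (-1) k0 k0 kQ s.
rewrite (_ : (fun y u => -1 * 0 + 0) = (fun _ _ => 0)); last first.
  by apply: rmvecP => y u; rewrite mulr0 addr0.
by rewrite mulN1r addNr.
Qed.

Lemma kmvec_sum k (I : Type) (e : seq I) (F : I -> rmvec A) :
  (forall i, kmvec k (F i)) ->
  kmvec k ((fun y u => \sum_(i <- e) F i y u) : rmvec A).
Proof.
move=> kF; elim: e => [|j e IH].
  rewrite (_ : (fun y u => _) = (fun _ _ => 0)); first exact: kmvec0.
  by apply: rmvecP => y u; rewrite big_nil.
rewrite (_ : (fun y u => _) = (fun y u => 1 * F j y u + \sum_(i <- e) F i y u)).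
  exact: (@kmvec_lin _ _ _ _ A k 1 (F j) _ (kF j) IH).
by apply: rmvecP => y u; rewrite big_cons mul1r.
Qed.

Lemma schouten_suml k l (I : Type) (e : seq I) Q (F : I -> rmvec A) x s :
  kmvec l Q -> (forall i, kmvec k (F i)) ->
  B (fun y u => \sum_(i <- e) F i y u) Q x s = \sum_(i <- e) B (F i) Q x s.
Proof.
move=> kQ kF; elim: e => [|i e IH].
  rewrite big_nil -[RHS](schouten0l s kQ); congr (B _ Q x s).
  by apply: rmvecP => y u; rewrite big_nil.
rewrite big_cons -IH -[B (F i) Q x s]mul1r.
rewrite -(schouten_linear hB 1 (kF i) (kmvec_sum e kF) kQ s).
by congr (B _ Q x s); apply: rmvecP => y u; rewrite big_cons mul1r.
Qed.

Lemma schouten_sumr k l (I : Type) (e : seq I) P (F : I -> rmvec A) x s :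
  kmvec k P -> (forall i, kmvec l (F i)) ->
  B P (fun y u => \sum_(i <- e) F i y u) x s = \sum_(i <- e) B P (F i) x s.
Proof.
move=> kP kF; rewrite (schouten_skew hB kP (kmvec_sum e kF)) (schouten_suml _ _ kP kF).
rewrite mulr_sumr -sumrN; apply: eq_bigr => i _.
by rewrite -(schouten_skew hB kP (kF i)).
Qed.

Lemma schouten_sec_decomposable X U V x s :
  Gamma A X -> Gamma A U -> Gamma A V ->
  B (sec_mvec X) (wedge_sec U V) x s =
  wedge_sec (lie LA X U) V x s + wedge_sec U (lie LA X V) x s.
Proof.
move=> sX sU sV.
rewrite (schouten_leibniz hB (kmvec_sec sX) (kmvec_sec sU) (kmvec_sec sV)).
rewrite muln1 expr2 mulN1r opprK mul1r.
rewrite (_ : B (sec_mvec X) (sec_mvec U) x = sec_mvec (lie LA X U) x); last first.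
  by apply: funext => u; rewrite (schouten_lie hB).
rewrite (_ : B (sec_mvec X) (sec_mvec V) x = sec_mvec (lie LA X V) x) //.
by apply: funext => u; rewrite (schouten_lie hB).
Qed.

(** The graded Leibniz rule and skew-symmetry reduce the left side to Lie brackets of sections; on
    the right, the derivative terms cancel between the two cyclic sums. *)
Lemma schouten_decomposable U V X Y xi eta theta x :
  Gamma A U -> Gamma A V -> Gamma A X -> Gamma A Y ->
  Gamma (dualb A) xi -> Gamma (dualb A) eta -> Gamma (dualb A) theta ->
  B (wedge_sec U V) (wedge_sec X Y) x [:: xi x; eta x; theta x] =
  hamilton_cyclic LA (sharp_sec U V) (sharp_sec X Y) xi eta theta x +
  hamilton_cyclic LA (sharp_sec X Y) (sharp_sec U V) xi eta theta x.
Proof.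
move=> sU sV sX sY sxi seta stheta.
have kD := kmvec_wedge_sec sU sV.
rewrite (schouten_leibniz hB kD (kmvec_sec sX) (kmvec_sec sY)).
have BE Z : Gamma A Z -> B (wedge_sec U V) (sec_mvec Z) x =
    fun s => - (wedge_sec (lie LA Z U) V x s + wedge_sec U (lie LA Z V) x s).
  move=> sZ; apply: funext => u.
  rewrite (schouten_skew hB kD (kmvec_sec sZ)) schouten_sec_decomposable //.
  by rewrite (_ : (3 * 2 = 6)%N) // -signr_odd mul1r.
rewrite !BE // !wedge3 /= !wedge_secE /hamilton_cyclic.
rewrite !hamilton_term_sharp_sec //.
rewrite (_ : (3 * 1 = 3)%N) // -signr_odd /=.
rewrite !(@wedge_sec_degree _ _ _ _ A _ _ _ [:: _]) //.
rewrite (lie_skew LA sY sV) (lie_skew LA sY sU) (lie_skew LA sX sV) (lie_skew LA sX sU).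
rewrite !pairingNr; ring.
Qed.

End SchoutenBracket.

(** * Local decomposition of a bivector *)

Section JacobiBivector.
Context (R : realType) (n : nat) (M : manifold R n).
Context (r : nat) (A : vbundle M r) (LA : lie_algebroid A).
Implicit Types (X Y Z U V : rsec A) (f g : M -> R) (P Q D p : rmvec A).
Implicit Types (xi eta theta : rsec (dualb A)).

Lemma anchor_sumv x (I : Type) (e : seq I) (u : I -> A x) f : Cinf M f ->
  anchor LA (\sum_(i <- e) u i) f = \sum_(i <- e) anchor LA (u i) f.
Proof.
move=> sf; elim: e => [|i e IH]; first by rewrite !big_nil anchor0v.
by rewrite !big_cons anchorDv // IH.
Qed.

Lemma Cinf_sum (I : Type) (e : seq I) (F : I -> M -> R) :
  (forall i, Cinf M (F i)) -> Cinf M (fun y => \sum_(i <- e) F i y).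
Proof. exact: smooth_fun_sum openT. Qed.

Lemma anchor_sum x (u : A x) (I : Type) (e : seq I) (F : I -> M -> R) :
  (forall i, Cinf M (F i)) ->
  anchor LA u (fun y => \sum_(i <- e) F i y) = \sum_(i <- e) anchor LA u (F i).
Proof.
move=> sF; elim: e => [|i e IH].
  rewrite big_nil -[RHS](anchor0 LA u); congr (anchor LA u _).
  by apply: funext => y; rewrite big_nil.
rewrite big_cons -IH -anchorD //; last exact: Cinf_sum.
by congr (anchor LA u _); apply: funext => y; rewrite big_cons.
Qed.

Lemma lie_suml (I : Type) (e : seq I) (F : I -> rsec A) Y x :
  (forall i, Gamma A (F i)) -> Gamma A Y ->
  lie LA (fun y => \sum_(i <- e) F i y) Y x = \sum_(i <- e) lie LA (F i) Y x.
Proof.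
move=> sF sY; elim: e => [|i e IH].
  have s0 := @Gamma0 _ _ _ _ A; have := @lieDl _ _ _ _ A LA _ _ _ x s0 s0 sY.
  rewrite (_ : (fun y => 0 + 0) = (fun=> 0)); last first.
    by apply: rsecP => y; rewrite addr0.
  rewrite big_nil => /eqP; rewrite -subr_eq subrr eq_sym => /eqP E.
  rewrite -[RHS]E; congr (lie LA _ Y x).
  by apply: rsecP => y; rewrite big_nil.
rewrite big_cons -IH -lieDl //; last exact: Gamma_sum.
by congr (lie LA _ Y x); apply: rsecP => y; rewrite big_cons.
Qed.

Lemma lie_sumr (I : Type) (e : seq I) (F : I -> rsec A) Y x :
  (forall i, Gamma A (F i)) -> Gamma A Y ->
  lie LA Y (fun y => \sum_(i <- e) F i y) x = \sum_(i <- e) lie LA Y (F i) x.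
Proof.
move=> sF sY; rewrite lie_skew ?lie_suml //; last exact: Gamma_sum.
by rewrite -sumrN; apply: eq_bigr => i _; rewrite (lie_skew LA sY (sF i)).
Qed.

Lemma hamilton_term_sum (I : Type) (e : seq I)
    (F : I -> rsec (dualb A) -> rsec A) xi eta theta x :
  (forall i z, Gamma (dualb A) z -> Gamma A (F i z)) ->
  Gamma (dualb A) xi -> Gamma (dualb A) eta -> Gamma (dualb A) theta ->
  let G (z : rsec (dualb A)) : rsec A := fun y => \sum_(i <- e) F i z y in
  hamilton_term LA G G xi eta theta x =
  \sum_(i <- e) \sum_(j <- e) hamilton_term LA (F i) (F j) xi eta theta x.
Proof.
move=> sF sxi seta stheta G; have sFx i := sF i _ sxi; have sFe i := sF i _ seta.
rewrite /hamilton_term /G lie_suml //; last exact: Gamma_sum.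
under eq_bigr do rewrite lie_sumr //.
rewrite (_ : (fun y => pairing (theta y) (\sum_(i <- e) F i eta y)) =
  (fun y => \sum_(i <- e) pairing (theta y) (F i eta y))); last first.
  by apply: funext => y; rewrite pairing_sumr.
have sp i : Cinf M (fun y => pairing (theta y) (F i eta y)) by exact: pairing_Gamma.
rewrite anchor_sumv; last exact: Cinf_sum.
rewrite pairing_sumr -sumrB; apply: eq_bigr => i _.
by rewrite anchor_sum // pairing_sumr -sumrB.
Qed.

Lemma hamilton_cyclic_sum (I : Type) (e : seq I)
    (F : I -> rsec (dualb A) -> rsec A) xi eta theta x :
  (forall i z, Gamma (dualb A) z -> Gamma A (F i z)) ->
  Gamma (dualb A) xi -> Gamma (dualb A) eta -> Gamma (dualb A) theta ->
  let G (z : rsec (dualb A)) : rsec A := fun y => \sum_(i <- e) F i z y in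
  hamilton_cyclic LA G G xi eta theta x =
  \sum_(i <- e) \sum_(j <- e) hamilton_cyclic LA (F i) (F j) xi eta theta x.
Proof.
move=> sF sxi seta stheta G; rewrite /hamilton_cyclic !hamilton_term_sum //.
by rewrite -!big_split; apply: eq_bigr => i _; rewrite -!big_split.
Qed.

(* The cutoff [psi * (2 - psi)] is 1 at [x0] and has zero derivative there as
   soon as [psi x0 = 1]. *)
Lemma local_decomposition p x0 : kmvec 2 p ->
  exists (psi : M -> R) (I : finType) (U V : I -> rsec A),
    [/\ Cinf M psi, psi x0 = 1, forall i, Gamma A (U i),
        forall i, Gamma A (V i) &
        forall x s, psi x * (2 - psi x) * p x s =
          \sum_(i <- enum I) wedge_sec (U i) (V i) x s].
Proof.
move=> kp; have [t tt tx0] := trivs_cover A x0.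
have ot := tdom_open t.
have [chi [K [schi chi1 cK Kt chi0]]] := bump_function ot tx0.
have dt : trivs (dualb A) (dtriv t) by exists t.
pose q i j x := p x [:: (frame (dtriv t) i x : dualb A x); frame (dtriv t) j x].
have sq i j : smooth_fun (tdom t) (q i j).
  exact: (kform_smooth kp dt [:: i; j]).
(* For psi = chi^2 the cutoff psi (2 - psi) is 2 chi^2 h. One factor chi goes to each of [U] and [V]
   to make them global, and the half accounts for summing over all ordered pairs of indices. *)
pose h x := 2^-1 * (2 - chi x * chi x).
have sh : Cinf M h.
  apply: CinfM; first exact: Cinf_cst.
  by apply: CinfD; [exact: Cinf_cst|apply: CinfN; exact: CinfM].
pose U (k : 'I_r * 'I_r) : rsec A :=
  fun x => chi x *: ((h x * q k.1 k.2 x) *: frame t k.1 x).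
pose V (k : 'I_r * 'I_r) : rsec A := fun x => chi x *: frame t k.2 x.
have sU k : Gamma A (U k).
  apply: (Gamma_cutoff ot cK Kt chi0 schi) => t' tt' j.
  have o' : open (tdom t' `&` tdom t) by apply: openI => //; exact: tdom_open.
  apply: (smooth_fun_eq o' _ (smooth_funM o' (smooth_funM o'
    (smooth_fun_sub _ sh) (smooth_fun_sub _ (sq k.1 k.2)))
    (smooth_frame k.1 tt tt' j))) => [y _|//|y []//].
  by rewrite linearZ mxE.
have sV k : Gamma A (V k).
  exact: (Gamma_cutoff ot cK Kt chi0 schi (smooth_frame k.2 tt)).
exists (fun x => chi x * chi x), ('I_r * 'I_r)%type, U, V.
split=> //; first exact: CinfM; first by rewrite chi1 mulr1.
move=> x s; have [s2|s2] := eqVneq (size s) 2; last first.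
  rewrite (kform_degree kp) // mulr0 big1 // => k _.
  exact: wedge_sec_degree.
case: s s2 => [|xi [|eta [|? ?]]] // _.
have [tx|ntx] := pselect (tdom t x); last first.
  rewrite chi0 ?mul0r; last by move=> /Kt.
  rewrite big1 // => k _; rewrite wedge_secE /U /V chi0; last by move=> /Kt.
  by rewrite !scale0r !pairing0r !mul0r subrr.
have pE (a b : dualb A x) : p x [:: a; b] = \sum_(k : 'I_r * 'I_r)
    pairing a (frame t k.1 x) * (pairing b (frame t k.2 x) * q k.1 k.2 x).
  rewrite {1}(dframe_expand a tx) {1}(dframe_expand b tx) kform2_suml //.
  rewrite -(pair_bigA _ (fun i j => pairing a (frame t i x) *
    (pairing b (frame t j x) * q i j x))) /=; apply: eq_bigr => i _.
  rewrite kform2_sumr //; apply: eq_bigr => j _.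
  by rewrite kform2Zl // kform2Zr.
have -> : p x [:: xi; eta] = 2^-1 * (p x [:: xi; eta] - p x [:: eta; xi]).
  by rewrite (kform2_skew eta) //=; field.
rewrite (pE xi eta) (pE eta xi) -sumrB !mulr_sumr big_enum.
apply: eq_bigr => k _; rewrite wedge_secE /U /V !pairingZr /h.
by ring.
Qed.

End JacobiBivector.

(** * Locality of the Schouten bracket and the square of a bivector *)

Section JacobiStructures.
Context (R : realType) (n : nat) (M : manifold R n).
Context (r : nat) (A : vbundle M r) (LA : lie_algebroid A).
Context (B : rmvec A -> rmvec A -> rmvec A) (hB : is_schouten LA B).
Arguments B : clear implicits.
Implicit Types (X Y Z U V : rsec A) (f g : M -> R) (P Q D p : rmvec A).
Implicit Types (xi eta theta : rsec (dualb A)).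

Lemma schouten_lin_r k l (a : R) D P Q x s :
  kmvec k D -> kmvec l P -> kmvec l Q ->
  B D (fun y u => a * P y u + Q y u) x s = a * B D P x s + B D Q x s.
Proof.
move=> kD kP kQ; rewrite (schouten_skew hB kD (kmvec_lin a kP kQ)).
rewrite (schouten_linear hB a kP kQ kD) (schouten_skew hB kD kP).
by rewrite (schouten_skew hB kD kQ); ring.
Qed.

Lemma schouten_fun_mul k D f g x s : kmvec k D -> Cinf M f -> Cinf M g ->
  B D (fun_mvec (fun y => f y * g y)) x s =
  g x * B D (fun_mvec f) x s + f x * B D (fun_mvec g) x s.
Proof.
move=> kD sf sg.
have -> : (fun_mvec (fun y => f y * g y) : rmvec A) =
    (fun y => wedge (fun_mvec f y) (fun_mvec g y)).
  apply: rmvecP => y u; rewrite (_ : wedge _ _ u = f y * fun_mvec g y u).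
    by case: u => //= ? ?; rewrite mulr0.
  exact: wedge_funl.
rewrite (schouten_leibniz hB kD (kmvec_fun A sf) (kmvec_fun A sg)).
rewrite muln0 expr0 mul1r (_ : wedge (fun_mvec f x) _ s = f x * B D (fun_mvec g) x s).
  by congr (_ + _); rewrite [RHS]mulrC; exact: wedge_funr.
exact: wedge_funl.
Qed.

(** Bracketing with [D] is a derivation on functions, so 2 psi - psi^2 yields (2 - 2 psi) times the
    bracket with [psi], which is zero where psi = 1. *)
Lemma schouten_cutoff k D psi x s : kmvec k D -> Cinf M psi -> psi x = 1 ->
  B D (fun_mvec (fun y => psi y * (2 - psi y))) x s = 0.
Proof.
move=> kD spsi psi1; have s2 := @Cinf_cst R n M 2.
have sN : Cinf M (fun y => - psi y * psi y) by apply: CinfM => //; exact: CinfN.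
have -> : (fun_mvec (fun y => psi y * (2 - psi y)) : rmvec A) =
    (fun y u => 2 * fun_mvec psi y u + fun_mvec (fun y => - psi y * psi y) y u).
  by apply: rmvecP => y [|? ?] /=; ring.
rewrite (schouten_lin_r _ _ kD (kmvec_fun A spsi) (kmvec_fun A sN)).
rewrite (@schouten_fun_mul k D (fun y => - psi y) psi) //; last exact: CinfN.
have kf := kmvec_fun A spsi; have k0 := @kmvec0 _ _ _ _ A 0.
have -> : (fun_mvec (fun y => - psi y) : rmvec A) =
    (fun y u => -1 * fun_mvec psi y u + 0).
  by apply: rmvecP => y [|? ?] /=; ring.
rewrite (schouten_lin_r _ _ kD kf k0) psi1.
rewrite (schouten_skew hB kD k0) (schouten0l hB _ kD); ring.
Qed.

Lemma anchor_cutoff x (u : A x) psi : Cinf M psi -> psi x = 1 ->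
  anchor LA u (fun y => psi y * (2 - psi y)) = 0.
Proof.
move=> spsi psi1; have s2 := @Cinf_cst R n M 2.
have sN : Cinf M (fun y => - psi y) by exact: CinfN.
have -> : (fun y => psi y * (2 - psi y)) =
    (fun y => 2 * psi y + - psi y * psi y) by apply: funext => y; ring.
rewrite anchorD; [|exact: CinfM|exact: CinfM].
rewrite anchorZ // anchorM // anchorN // psi1; ring.
Qed.

(** In the Leibniz rule the bracket with the cutoff vanishes at [x] and the cutoff itself is 1. This
    locality lets a bivector be replaced by a globally decomposed one. *)
Lemma schouten_mul_cutoff k l D P psi x s : kmvec k D -> kmvec l P ->
  Cinf M psi -> psi x = 1 ->
  B D (fun y u => psi y * (2 - psi y) * P y u) x s = B D P x s.
Proof.
move=> kD kP spsi psi1; set g := fun y => psi y * (2 - psi y).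
have sg : Cinf M g.
  apply: CinfM => //; apply: CinfD; first exact: Cinf_cst.
  exact: CinfN.
have -> : (fun y u => g y * P y u) = (fun y => wedge (fun_mvec g y) (P y)).
  by apply: rmvecP => y u; apply/esym; exact: wedge_funl.
rewrite (schouten_leibniz hB kD (kmvec_fun A sg) kP) muln0 expr0 mul1r.
rewrite [X in X + _]big1 => [|m _]; last first.
  by rewrite (schouten_cutoff _ kD spsi psi1) mulr0 mul0r.
rewrite add0r; transitivity (g x * B D P x s); first exact: wedge_funl.
by rewrite /g psi1 (_ : 2 - 1 = 1) ?mul1r //; ring.
Qed.

(** At [x] the cutoff [g] changes neither side, and [g p] is a sum of decomposable bivectors, over
    which both sides expand bilinearly. *)
Lemma schouten_bivector p xi eta theta x : kmvec 2 p ->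
  Gamma (dualb A) xi -> Gamma (dualb A) eta -> Gamma (dualb A) theta ->
  B p p x [:: xi x; eta x; theta x] =
  2 * hamilton_cyclic LA (fun z y => sharp p y (z y)) (fun z y => sharp p y (z y))
        xi eta theta x.
Proof.
move=> kp sxi seta stheta.
have [psi [I [U [V [spsi psi1 sU sV pE]]]]] := local_decomposition x kp.
pose g y := psi y * (2 - psi y).
have sg : Cinf M g.
  apply: CinfM => //; apply: CinfD; first exact: Cinf_cst.
  exact: CinfN.
have g1 : g x = 1 by rewrite /g psi1; ring.
have kgp : kmvec 2 ((fun y u => g y * p y u) : rmvec A) by exact: kmvecZ.
have kUV i : kmvec 2 (wedge_sec (U i) (V i)) by exact: kmvec_wedge_sec.
pose F i := sharp_sec (U i) (V i).
have sF i z : Gamma (dualb A) z -> Gamma A (F i z) by exact: sharp_sec_Gamma.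
pose G (z : rsec (dualb A)) : rsec A := fun y => \sum_(i <- enum I) F i z y.
have GE z : G z = fun y => g y *: sharp p y (z y).
  apply: rsecP => y; apply/eqP; rewrite -subr_eq0; apply/eqP.
  apply: dual_separates => a _; rewrite pairingDr pairingNr pairingZr sharpE //.
  rewrite pE pairing_sumr -sumrB big1 // => i _.
  by rewrite /F /sharp_sec pairingDr !pairingZr wedge_secE; ring.
have sp z : Gamma (dualb A) z -> Gamma A (fun y => sharp p y (z y)).
  by move=> sz; apply: sharp_smooth kp openT sz.
have dg u : anchor LA (u : A x) g = 0 by exact: anchor_cutoff.
have termE a b c : Gamma (dualb A) a -> Gamma (dualb A) b -> Gamma (dualb A) c ->
    hamilton_term LA G G a b c x =
    hamilton_term LA (fun z y => sharp p y (z y)) (fun z y => sharp p y (z y)) a b c x.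
  move=> sa sb sc; rewrite /hamilton_term !GE lieZZ ?dg ?g1; try by auto.
  rewrite !mulr0 !scale0r subr0 addr0 mul1r !scale1r; congr (_ - _).
  have -> : (fun y => pairing (c y) (g y *: sharp p y (b y))) =
      (fun y => g y * pairing (c y) (sharp p y (b y))).
    by apply: funext => y; rewrite pairingZr.
  rewrite anchorM //; last by apply: pairing_Gamma => //; exact: sp.
  by rewrite dg g1 mul0r add0r mul1r.
have <- : hamilton_cyclic LA G G xi eta theta x = hamilton_cyclic LA
    (fun z y => sharp p y (z y)) (fun z y => sharp p y (z y)) xi eta theta x.
  by rewrite /hamilton_cyclic !termE.
rewrite hamilton_cyclic_sum //.
(* The cutoff is inserted in both arguments, in the first one through skew-symmetry, whose sign for
   two bivectors is +1. *)
rewrite -(schouten_mul_cutoff _ kp kp spsi psi1).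
rewrite (schouten_skew hB kp kgp) -(schouten_mul_cutoff _ kgp kp spsi psi1).
rewrite -/(g _).
rewrite (_ : (fun y u => _) = (fun y u =>
    \sum_(i <- enum I) wedge_sec (U i) (V i) y u)); last first.
  by apply: rmvecP => y u; rewrite pE.
rewrite (schouten_suml hB _ _ (kmvec_sum _ kUV) kUV).
under eq_bigr do rewrite (schouten_sumr hB _ _ (kUV _) kUV).
under eq_bigr => i _ do under eq_bigr => j _ do rewrite (schouten_decomposable hB) //.
rewrite (_ : (3 * 3 = 9)%N) // -signr_odd /= mulN1r opprK.
(* Exchanging the two summation indices identifies the double sums, whence the factor 2. *)
under eq_bigr => i _ do rewrite big_split.
rewrite big_split /= [X in _ + X]exchange_big /=.
by rewrite mulr_natl mulr2n.
Qed.

End JacobiStructures.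

(** * Cographs of Jacobi structures *)

Section Cographs.
Context (R : realType) (n : nat) (M : manifold R n).
Context (r : nat) (A : vbundle M r) (LA : lie_algebroid A).
Context (phi0 : rsec (dualb A)).
Implicit Types (X Y Z W : rsec A) (w : rform A) (p : rmvec A).
Implicit Types (xi eta theta : rsec (dualb A)).

Lemma sharp_skew p x (xi eta : dualb A x) : kmvec 2 p ->
  pairing eta (sharp p x xi) = - pairing xi (sharp p x eta).
Proof. by move=> kp; rewrite !sharpE // kform2_skew. Qed.

Lemma sharp_Gamma p xi : kmvec 2 p -> Gamma (dualb A) xi ->
  Gamma A (fun x => sharp p x (xi x)).
Proof. by move=> kp; apply: sharp_smooth kp openT. Qed.

(** The cochain is linear over smooth functions in [W], the derivatives of the coefficient
    cancelling, so tensoriality supplies the section that [courant_closed] asks for. *)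
Lemma courant_section X xi Y eta :
  Gamma (dualb A) phi0 -> Gamma A X -> Gamma A Y ->
  Gamma (dualb A) xi -> Gamma (dualb A) eta ->
  exists2 zeta, Gamma (dualb A) zeta & forall W, Gamma A W -> forall x,
    pairing (zeta x) (W x) = courant_cochain LA phi0 X xi Y eta [:: W] x.
Proof.
move=> sphi sX sY sxi seta.
have spm : Cinf M (fun y => pair_minus (X y, xi y) (Y y, eta y)).
  apply: CinfM; first exact: Cinf_cst.
  by apply: CinfD; [|apply: CinfN]; exact: pairing_Gamma.
apply: (tensorial_section
  (c := fun W x => courant_cochain LA phi0 X xi Y eta [:: W] x)) => [W sW|f W W' sf sW sW' x].
  refine (smooth_fun_eq openT (fun x _ => esym (@courant_cochainE _ _ _ _ _ LA
    phi0 X xi Y eta W x sX sY sW sxi seta)) _).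
  have sa Z f : Gamma A Z -> Cinf M f -> Cinf M (fun x => anchor LA (Z x) f).
    exact: anchor_smooth.
  have sp Z (z : rsec (dualb A)) : Gamma A Z -> Gamma (dualb A) z ->
      Cinf M (fun x => pairing (z x) (Z x)) by move=> *; exact: pairing_Gamma.
  have sl Z Z' : Gamma A Z -> Gamma A Z' -> Gamma A (lie LA Z Z').
    exact: lie_smooth.
  have sB f g : Cinf M f -> Cinf M g -> Cinf M (fun x => f x - g x).
    by move=> sf sg; apply: CinfD => //; exact: CinfN.
  have sM := @CinfM _ _ M; have sD := @CinfD _ _ M.
  exact: sD _ _ (sD _ _ (sB _ _ (sD _ _ (sB _ _ (sD _ _ (sB _ _
    (sa _ _ sX (sp _ _ sW seta)) (sp _ _ (sl _ _ sX sW) seta))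
    (sM _ _ (sp _ _ sX sphi) (sp _ _ sW seta)))
    (sa _ _ sY (sp _ _ sW sxi))) (sp _ _ (sl _ _ sY sW) sxi))
    (sM _ _ (sp _ _ sY sphi) (sp _ _ sW sxi))) (sa _ _ sW spm))
    (sM _ _ (sp _ _ sW sphi) spm).
have sZ := GammaZ sf sW; have sL := GammaL sf sW sW'.
rewrite !courant_cochainE // lieDr // lieDr // lieZr // lieZr //.
have pL (z : rsec (dualb A)) :
    (fun y => pairing (z y) (f y *: W y + W' y)) =
    (fun y => f y * pairing (z y) (W y) + pairing (z y) (W' y)).
  by apply: funext => y; rewrite pairingDr pairingZr.
have aE (u : A x) (z : rsec (dualb A)) : Gamma (dualb A) z ->
    anchor LA u (fun y => f y * pairing (z y) (W y) + pairing (z y) (W' y)) =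
    anchor LA u f * pairing (z x) (W x) + f x * anchor LA u (fun y => pairing (z y) (W y))
    + anchor LA u (fun y => pairing (z y) (W' y)).
  move=> sz; have sp V : Gamma A V -> Cinf M (fun y => pairing (z y) (V y)).
    by move=> sV; exact: pairing_Gamma.
  by rewrite anchorD ?anchorM; auto; apply: CinfM => //; exact: sp.
rewrite !pL !aE // anchor_linear // !pairingDr !pairingZr; ring.
Qed.

Context (B : rmvec A -> rmvec A -> rmvec A) (hB : is_schouten LA B).

(** By skewness of [p], the Courant cochain provides the rest of the cyclic sum, and its [phi0] part
    is the wedge of the contraction of [p] by [phi0] with [p]; the total is half of the bracket
    [p, p] twisted by [phi0]. *)
Lemma jacobi_courant p xi eta theta x : jacobi_structure phi0 B p ->
  Gamma (dualb A) xi -> Gamma (dualb A) eta -> Gamma (dualb A) theta ->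
  let S z : rsec A := fun y => sharp p y (z y) in
  pairing (theta x) (lie LA (S xi) (S eta) x) +
  courant_cochain LA phi0 (S xi) xi (S eta) eta [:: S theta] x = 0.
Proof.
move=> [kp jac] sxi seta stheta S.
have sS z : Gamma (dualb A) z -> Gamma A (S z) by exact: sharp_Gamma.
have {}jac := jac x [:: xi x; eta x; theta x]; move: jac.
rewrite /jacobi_bracket (schouten_bivector hB x kp sxi seta stheta).
rewrite !wedge3 /Defs.contract !(@kform_degree _ _ _ _ _ _ _ kp x [:: _]) //.
rewrite !(@kform_degree _ _ _ _ _ _ _ kp x [:: _; _; _]) //.
rewrite !(@kform_degree _ _ _ _ _ _ _ kp x [:: _; _; _; _]) //.
rewrite /hamilton_cyclic /hamilton_term -/(S _) => jac.
rewrite courant_cochainE //; try exact: sS.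
have swap (a b : rsec (dualb A)) : (fun y => pairing (a y) (S b y)) =
    (fun y => - pairing (b y) (S a y)).
  by apply: funext => y; exact: sharp_skew.
have pmE : (fun y => pair_minus (S xi y, xi y) (S eta y, eta y)) =
    (fun y => - pairing (eta y) (S xi y)).
  apply: funext => y; rewrite /pair_minus /= [pairing (xi y) _]sharp_skew //.
  by rewrite -/(S xi y); field.
rewrite pmE (swap eta theta) !anchorN; try by apply: pairing_Gamma => //; exact: sS.
have pmx : pair_minus (S xi x, xi x) (S eta x, eta x) = - pairing (eta x) (S xi x).
  exact: (congr1 (fun h => h x) pmE).
rewrite pmx (lie_skew LA (sS _ sxi) (sS _ stheta)).
rewrite /S !sharpE // in jac *.
rewrite -/(S xi) -/(S eta) -/(S theta) in jac *.
have sk a b : p x [:: a; b] = - p x [:: b; a] by exact: kform2_skew.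
rewrite (sk (theta x) (eta x)) (sk (theta x) (xi x)) (sk (xi x) (phi0 x)).
rewrite (sk (eta x) (phi0 x)) (sk (theta x) (phi0 x)).
rewrite pairingNr.
by move: jac; lra.
Qed.

Lemma jacobi_cograph_dirac p : Gamma (dualb A) phi0 ->
  jacobi_structure phi0 B p -> dirac_structure LA phi0 (cograph_map (sharp p)).
Proof.
move=> sphi jac; have [kp _] := jac; split.
- apply: (@subbundle_range _ _ _ _ _ (dualb A)
    (fun x (a : dualb A x) => sharp p x a) (fun x a => a)) => //.
  + by move=> x a u v; exact: linearP.
  + by move=> U Z oU sZ; split=> //; exact: sharp_smooth.
- by apply: cograph_maximally_isotropic => x a b; exact: sharp_skew.
- move=> X xi Y eta sX sxi sY seta LX LY.
  have XE : X = fun x => sharp p x (xi x).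
    by apply: rsecP => x; exact/cograph_mapE/LX.
  have YE : Y = fun x => sharp p x (eta x).
    by apply: rsecP => x; exact/cograph_mapE/LY.
  have [zeta szeta zE] := courant_section sphi sX sY sxi seta.
  exists zeta; split=> // x; apply/cograph_mapE.
  (* Paired with [theta], and with [sharp p] moved across by skewness, the required equality becomes
     [jacobi_courant]. *)
  apply/eqP; rewrite -subr_eq0; apply/eqP; apply: dual_separates => theta stheta.
  rewrite pairingDr pairingNr sharp_skew // opprK.
  rewrite (zE _ (sharp_Gamma kp stheta)) XE YE.
  exact: jacobi_courant.
Qed.

(* The section [zeta] is the bracket of [w X] and [w Y] induced by [p] on the
   dual of [A]. *)
Lemma JOmega_bracket p w X Y
    (N := (fun x => (sharp p x \o flat w x)%VF) : forall x, 'End(A x)) :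
  kmvec 2 p -> presymplectic LA phi0 w -> kform 2 (Defs.formN w N) ->
  courant_closed LA phi0 (cograph_map (sharp p)) ->
  Gamma A X -> Gamma A Y ->
  exists2 zeta : rsec (dualb A),
    forall x, lie LA (fun y => N y (X y)) (fun y => N y (Y y)) x =
      sharp p x (zeta x) &
    forall Z, Gamma A Z -> forall x, pairing (zeta x) (Z x) +
      dphi3 LA phi0 (Defs.formN w N) X Y Z x =
      w x [:: lie LA (fun y => N y (X y)) Y x; Z x]
      + w x [:: lie LA X (fun y => N y (Y y)) x; Z x]
      - w x [:: N x (lie LA X Y x); Z x].
Proof.
move=> kp pw kN cl sX sY; have [kw _] := pw.
have /(presymplecticP _ _ kw) dw := pw.
have sw V : Gamma A V -> Gamma (dualb A) (fun y => flat w y (V y)).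
  exact: flat_Gamma.
have NE V : (fun y => N y (V y)) = (fun y => sharp p y (flat w y (V y))).
  by apply: rsecP => y; rewrite /N comp_lfunE.
have sN V : Gamma A V -> Gamma A (fun y => N y (V y)).
  by move=> sV; rewrite NE; apply: sharp_Gamma => //; exact: sw.
have LN V y : cograph_map (sharp p) (N y (V y), flat w y (V y)).
  by apply/cograph_mapE; rewrite /N comp_lfunE.
have [zeta [_ zE zL]] :=
  cl _ _ _ _ (sN _ sX) (sw _ sX) (sN _ sY) (sw _ sY) (LN X) (LN Y).
exists zeta => [x|Z sZ x]; first exact/cograph_mapE.
rewrite zE // (courant_recursion LA phi0 x kw kN sX (sN _ sX) sY (sN _ sY) sZ).
- rewrite !dw ?addr0; try by [|exact: sN].
  by rewrite formNE.
- by move=> y v; rewrite formNE.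
- by move=> y v; rewrite formNE.
Qed.

End Cographs.

(** * J-Omega and Omega-N structures versus Dirac pairs *)

Theorem theorem4p6 (R : realType) (n r : nat) (M : manifold R n)
  (A : vbundle M r) (LA : lie_algebroid A)
  (B : rmvec A -> rmvec A -> rmvec A) (hB : is_schouten LA B)
  (phi0 : rsec (dualb A)) (hphi0 : jacobi_algebroid LA phi0)
  (p : rmvec A) (hp : jacobi_structure phi0 B p)
  (w : rform A) (hw : presymplectic LA phi0 w)
  (N : forall x, 'End(A x)) (hN : tensor11 N) :
  ((JOmega_structure LA phi0 B p w ->
      dirac_pair LA phi0 (cograph_map (sharp p)) (graph_map (flat w))) /\
   (dirac_pair LA phi0 (cograph_map (sharp p)) (graph_map (flat w)) ->
      nondegenerate_bivector p ->
      JOmega_structure LA phi0 B p w)) /\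
  (let L := graph_map (flat w) in
   let L' := graph_map (flatN w N) in
   (OmegaN_structure LA phi0 w N ->
      (forall x, Nplus w N x = rel_dual (Nrel L L') x) ->
      dirac_pair LA phi0 L L') /\
   (dirac_pair LA phi0 L L' -> weak_OmegaN_structure LA phi0 w N)).
Proof.
have [kw _] := hw; have [kp _] := hp; have [sphi _] := hphi0.
have sN : smooth_endo N by move=> U X oU; exact: bundle_map_smooth.
split; last first.
  split; first exact: OmegaN_dirac_pair.
  exact: dirac_pair_weak_OmegaN.
pose N' x : 'End(A x) := (sharp p x \o flat w x)%VF.
have sN' : smooth_endo N'.
  move=> U X oU sX.
  have -> : (fun x => N' x (X x)) = (fun x => sharp p x (flat w x (X x))).
    by apply: rsecP => x; rewrite /N' comp_lfunE.
  by apply: sharp_smooth => //; exact: flat_smooth.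
(* Up to sign, w(N' u, u) is p(w u, w u), which vanishes. *)
have kN' : kform 2 (Defs.formN w N').
  apply: kform_formN => // x u.
  by rewrite kform2_skew // -flatE // comp_lfunE sharpE // kform2_alt // oppr0.
(* The relation is the graph of N', so its torsion is that of an ordinary operator. *)
have SE x u v : Nrel (cograph_map (sharp p)) (graph_map (flat w)) x (u, v) <->
    v = N' x u.
  rewrite /N' comp_lfunE; split=> [[a [/graph_mapE /= -> /cograph_mapE]] //|->].
  by exists (flat w x u); split; [exact/graph_mapE|exact/cograph_mapE].
have dL := jacobi_cograph_dirac hB sphi hp.
have [_ _ cl] := dL.
split=> [[_ _ pN']|[_ _ /(Nijenhuis_graph _ sN' SE) NN] nd].
  split=> //; first exact: presymplectic_graph_dirac.
  apply/(Nijenhuis_graph _ sN' SE) => X Y sX sY x.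
  have [zeta lE zE] := JOmega_bracket kp hw kN' cl sX sY.
  have /(presymplecticP _ _ kN') dN' := pN'.
  (* Closedness of the second form removes the differential from [zE], and pairing with all sections
     identifies [zeta]; applying [sharp p] then gives the torsion identity. *)
  have zetaE : zeta x = flat w x (lie LA (fun y => N' y (X y)) Y x
      + lie LA X (fun y => N' y (Y y)) x - N' x (lie LA X Y x)).
    apply/eqP; rewrite -subr_eq0; apply/eqP; apply: separates => Z sZ.
    rewrite pairingDl pairingNl; have := zE Z sZ x; rewrite dN' // addr0 => ->.
    by rewrite !linearD linearN !pairingDl pairingNl !flatE // subrr.
  have cancel (V : zmodType) (a b c : V) : a + b - c - a - b + c = 0.
    by rewrite -[_ - a - b]addrA -opprD [_ - (a + b)]addrAC subrr sub0r addNr.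
  rewrite /torsion lE zetaE -comp_lfunE -/(N' x) linearB linearD.
  exact: cancel.
split=> //; apply/presymplecticP => // X Y Z sX sY sZ x.
have [zeta lE zE] := JOmega_bracket kp hw kN' cl sX sY.
have zetaE : zeta x = flat w x (lie LA (fun y => N' y (X y)) Y x
    + lie LA X (fun y => N' y (Y y)) x - N' x (lie LA X Y x)).
  have solve (V : zmodType) (l a b c : V) : l - a - b + c = 0 -> l = a + b - c.
    move=> T0; apply/eqP; rewrite eq_sym subr_eq eq_sym -subr_eq0 opprD addrA.
    by rewrite (addrAC _ c) (addrAC _ c) T0.
  (* Injectivity of [sharp p] lifts the vanishing of the torsion, an identity of vectors, to the
     identity of covectors. *)
  apply: (bij_inj (nd x)); rewrite -lE -comp_lfunE -/(N' x) linearB linearD.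
  exact/solve/NN.
(* This value of [zeta] accounts for the whole right-hand side of [zE], which leaves the
   differential equal to 0. *)
have := zE Z sZ x; rewrite zetaE !linearD linearN !pairingDl pairingNl !flatE //.
by rewrite -[in X in _ = X -> _](addr0 (_ - _)) => /addrI.
Qed.
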